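(* Let $\phi\in C_c^\infty(\mathbb{R}^n)$, $\int_{\mathbb{R}^n}\phi\,dx=1$, $\mathrm{supp}\,\phi\subseteq\overline{\mathbb{B}_n(0,1)}$. Let $p\in[1,+\infty]$. Let $w$ be a function from $]0,+\infty[$ to $[0,+\infty[$. Assume that there exists $r_0\in]0,+\infty[$ such that $w(r_0)\neq 0$. If $f\in\mathcal{M}_p^{w,Z}(\mathbb{R}^n)$, then $$f*\phi_\epsilon\in\mathcal{M}_p^w(\mathbb{R}^n)\cap C^\infty(\mathbb{R}^n)$$ for all $\epsilon\in]0,+\infty[$ and $$\lim_{\epsilon\to 0}f*\phi_\epsilon=f\qquad\text{in }\mathcal{M}_p^w(\mathbb{R}^n).$$
   Context: Here $n\geq 1$ is an integer, $]a,b[$ denotes an open interval, $\mathbb{B}_n(x,r)$ is the open Euclidean ball with center $x$ and radius $r$, and $L^p$ is with respect to Lebesgue measure. Functions are real valued and are identified when equal almost everywhere. For $t\in]0,+\infty[$, $\phi_t(x)\equiv t^{-n}\phi(x/t)$, and $f*\phi_\epsilon(x)\equiv\int_{\mathbb{R}^n}f(x-y)\phi_\epsilon(y)\,dy$ for all $x\in\mathbb{R}^n$. For $y\in\mathbb{R}^n$, $\tau_yf$ is the translate $\tau_yf(x)\equiv f(x-y)$. For $p\in[1,+\infty]$, a function $w:]0,+\infty[\to[0,+\infty[$ not identically zero and a measurable $f:\mathbb{R}^n\to\mathbb{R}$, set $$\|f\|_{\mathcal{M}_p^w(\mathbb{R}^n)}\equiv\sup_{(x,r)\in\mathbb{R}^n\times]0,+\infty[}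 w(r)\|f\|_{L^p(\mathbb{B}_n(x,r))}\in[0,+\infty]$$ (with $0\cdot(+\infty)=0$). The generalized Morrey space $\mathcal{M}_p^w(\mathbb{R}^n)$ is the normed space of measurable $f:\mathbb{R}^n\to\mathbb{R}$ for which this quantity is finite. Zorko's subspace is $$\mathcal{M}_p^{w,Z}(\mathbb{R}^n)\equiv\{f\in\mathcal{M}_p^w(\mathbb{R}^n):\ \lim_{y\to 0}\tau_yf=f\text{ in }\mathcal{M}_p^w(\mathbb{R}^n)\}.$$ *)

(* Defs.v *)
From HB Require Import structures.
From mathcomp Require Import all_boot all_order all_algebra.
From mathcomp Require Import all_classical all_reals all_analysis.

Set Implicit Arguments.
Unset Strict Implicit.
Unset Printing Implicit Defensive.

Import Order.TTheory GRing.Theory Num.Theory.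
Import numFieldNormedType.Exports.

Local Open Scope classical_set_scope.
Local Open Scope ring_scope.

(* The product sigma-algebra on R^n, generated by the coordinate functions,
   i.e. the Borel sets of R^n. *)
Section borel_rV.
Context {R : realType} (n : nat).

Let coor (i : 'I_n) (v : 'rV[R]_n) : measurableTypeR R := v ord0 i.

Let rV_set0 : g_sigma_preimage coor set0.
Proof. exact: sigma_algebra0. Qed.

Let rV_setC A : g_sigma_preimage coor A -> g_sigma_preimage coor (~` A).
Proof. exact: sigma_algebraC. Qed.

Let rV_bigcup (F : (set 'rV[R]_n)^nat) :
  (forall i, g_sigma_preimage coor (F i)) ->
  g_sigma_preimage coor (\bigcup_i (F i)).
Proof. exact: sigma_algebra_bigcup. Qed.

HB.instance Definition _ := @isMeasurable.Build default_measure_display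
  'rV[R]_n (g_sigma_preimage coor) rV_set0 rV_setC rV_bigcup.

Lemma measurable_rV_coord (i : 'I_n) :
  measurable_fun [set: 'rV[R]_n]
    (fun v : 'rV[R]_n => v ord0 i : measurableTypeR R).
Proof.
move=> _ Y mY; rewrite setTI; apply: sub_sigma_algebra => /=.
rewrite -bigcup_seq/=; exists i => /=; first by rewrite mem_index_enum.
by exists Y => //; rewrite setTI.
Qed.

Lemma measurable_fun_rVP d (T : measurableType d) (f : T -> 'rV[R]_n) :
  (forall i,
    measurable_fun [set: T] (fun t => f t ord0 i : measurableTypeR R)) ->
  measurable_fun [set: T] f.
Proof.
move=> mf _ Y mY; rewrite setTI.
have : preimage_set_system [set: T] f (g_sigma_preimage coor) (f @^-1` Y).
  by exists Y => //; rewrite setTI.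
rewrite /g_sigma_preimage -g_sigma_preimageE.
apply: smallest_sub; first exact: sigma_algebra_measurable.
move=> _ [B + <-]; rewrite -bigcup_seq => -[i _ [C mC <-]].
by rewrite !setTI; have := mf i measurableT C mC; rewrite setTI.
Qed.

End borel_rV.

Section rV_measure.
Context {R : realType}.

Definition rV_cons n (tv : measurableTypeR R * 'rV[R]_n) : 'rV[R]_n.+1 :=
  row_mx (tv.1 : R)%:M tv.2.

Definition rV_uncons n (v : 'rV[R]_n.+1) : measurableTypeR R * 'rV[R]_n :=
  (v ord0 ord0, rsubmx (v : 'rV[R]_(1 + n))).

Lemma rV_consK n : cancel (@rV_cons n) (@rV_uncons n).
Proof.
move=> [t v]; rewrite /rV_uncons /rV_cons row_mxKr; congr (_, _).
have -> : ord0 = lshift n ord0 :> 'I_(1 + n) by exact/val_inj.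
by apply: etrans (row_mxEl _ _ _ _) _; rewrite mxE.
Qed.

Lemma measurable_rV_cons n : measurable_fun setT (@rV_cons n).
Proof.
apply: measurable_fun_rVP => i; rewrite /rV_cons.
case: (splitP (i : 'I_(1 + n))) => j ij.
  have -> : i = lshift n j by exact/val_inj.
  rewrite (_ : (fun _ => _) = fst)//; apply/funext => tv.
  by apply: (etrans (row_mxEl _ _ _ _)); rewrite (ord1 j) mxE.
have -> : i = rshift 1 j by exact/val_inj.
rewrite (_ : (fun _ => _) =
    (fun v : 'rV[R]_n => v ord0 j : measurableTypeR R) \o snd).
  by apply: measurableT_comp => //; exact: measurable_rV_coord.
by apply/funext => tv /=; exact: row_mxEr.
Qed.

Lemma measurable_rV_uncons n : measurable_fun setT (@rV_uncons n).
Proof.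
apply/measurable_fun_pairP; split; first exact: measurable_rV_coord.
apply: measurable_fun_rVP => i.
rewrite (_ : (fun _ => _) =
    (fun v : 'rV[R]_n.+1 => v ord0 (rshift 1 i) : measurableTypeR R)).
  exact: measurable_rV_coord.
by apply/funext => v /=; rewrite mxE.
Qed.

Section step.
Context n (mu : {sigma_finite_measure set 'rV[R]_n -> \bar R}).

Definition rV_measureS : set 'rV[R]_n.+1 -> \bar R :=
  pushforward (@lebesgue_measure R \x mu)%E (@rV_cons n).

Let rV_measureS0 : rV_measureS set0 = 0%E.
Proof. by rewrite /rV_measureS /pushforward preimage_set0 measure0. Qed.

Let rV_measureS_ge0 A : (0 <= rV_measureS A)%E.
Proof. by rewrite /rV_measureS /pushforward; apply: measure_ge0. Qed.

Let rV_measureS_sigma_additive : semi_sigma_additive rV_measureS.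
Proof.
have mcons A : measurable A -> measurable (@rV_cons n @^-1` A).
  by move=> mA; rewrite -[X in measurable X]setTI; exact: measurable_rV_cons.
move=> F mF tF mUF; rewrite /rV_measureS /pushforward preimage_bigcup.
apply: measure_semi_sigma_additive.
- by move=> k; exact: mcons.
- apply/trivIsetP => /= i j _ _ ij; rewrite -preimage_setI.
  by move/trivIsetP : tF => /(_ _ _ _ _ ij) ->//; rewrite preimage_set0.
- by rewrite -preimage_bigcup; exact: mcons.
Qed.

HB.instance Definition _ := isMeasure.Build _ _ _ rV_measureS
  rV_measureS0 rV_measureS_ge0 rV_measureS_sigma_additive.

Let rV_measureS_sigma_finite : sigma_finite setT rV_measureS.
Proof.
have /sigma_finiteP[F [TF ndF Foo]] := sigma_finiteT (@lebesgue_measure R).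
have /sigma_finiteP[G [TG ndG Goo]] := sigma_finiteT mu.
exists (fun k => @rV_uncons n @^-1` (F k `*` G k)).
  rewrite -preimage_bigcup -[LHS](@preimage_setT _ _ (@rV_uncons n)).
  congr (_ @^-1` _); rewrite -setXTT TF TG predeqE => -[x y]; split.
    move=> [/= [i _ Fix] [k _ Gky]]; exists (maxn i k) => //; split.
    - by move: x Fix; exact/subsetPset/ndF/leq_maxl.
    - by move: y Gky; exact/subsetPset/ndG/leq_maxr.
  by move=> [i _ []/= ? ?]; split; exists i.
move=> k; have [mF Fk] := Foo k; have [mG Gk] := Goo k; split.
  rewrite -[X in measurable X]setTI.
  exact: (@measurable_rV_uncons n measurableT _ (measurableX mF mG)).
rewrite /rV_measureS /pushforward -comp_preimage.
rewrite (_ : _ \o _ = id); last by apply/funext => tv /=; rewrite rV_consK.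
by rewrite preimage_id product_measure1E// lte_mul_pinfty// ge0_fin_numE.
Qed.

HB.instance Definition _ := Measure_isSigmaFinite.Build _ _ _ rV_measureS
  rV_measureS_sigma_finite.
End step.

(* The n-fold product of the one-dimensional Lebesgue measure, on the Borel
   sets of R^n. *)
Fixpoint borel_lebesgue n : {sigma_finite_measure set 'rV[R]_n -> \bar R} :=
  if n is n'.+1 then rV_measureS (borel_lebesgue n') else \d_(0 : 'rV[R]_0).

Lemma borel_lebesgue_box n (F : 'I_n -> set (measurableTypeR R)) :
  (forall i, measurable (F i)) ->
  borel_lebesgue n [set v | forall i, F i (v ord0 i)] =
  (\prod_(i < n) lebesgue_measure (F i))%E.
Proof.
elim: n F => [|n IH] F mF.
  rewrite big_ord0 /= diracE mem_set//= => -[]//.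
rewrite big_ord_recl -(IH (fun i => F (lift ord0 i)))//.
rewrite -product_measure1E//; last first.
  rewrite [X in measurable X](_ : _ = \bigcap_(i in setT)
      ((fun v : 'rV[R]_n => v ord0 i : measurableTypeR R) @^-1`
       F (lift ord0 i))).
    apply: fin_bigcap_measurable => // i _.
    rewrite -[X in measurable X]setTI.
    exact: (@measurable_rV_coord _ n i measurableT _ (mF _)).
  by apply/seteqP; split => v /= H i; [move=> _; exact: H|exact: H].
rewrite /= /rV_measureS /pushforward; congr (_ _).
have c0 t v : @rV_cons n (t, v) ord0 ord0 = t.
  exact: (congr1 fst (rV_consK (t, v))).
have cS t v j : @rV_cons n (t, v) ord0 (lift ord0 j) = v ord0 j.
  rewrite -[in RHS](congr1 snd (rV_consK (t, v)) : _ = v) [RHS]mxE.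
  by congr (rV_cons _ _ _); exact/val_inj.
rewrite predeqE => -[t v]; split => /= H.
  by split=> [|i]; [rewrite -(c0 t v)|rewrite -(cS t v)]; exact: H.
by move=> i; case: (unliftP ord0 i) => [j|] ->;
  [rewrite cS|rewrite c0]; case: H.
Qed.

(* R^n with its Lebesgue measurable sets: the Caratheodory measurable sets for
   the outer measure induced by [borel_lebesgue n] (equivalently, the
   completion of the Borel sets). *)
Definition rV_lebesgue n := caratheodory_type ((@borel_lebesgue n)^*)%mu.

HB.instance Definition _ n := Measurable.on (rV_lebesgue n).

Definition lebesgue_rV n : {measure set (rV_lebesgue n) -> \bar R} :=
  @completed_measure_extension _ _ _ (borel_lebesgue n).

Lemma lebesgue_rV_borel n (A : set 'rV[R]_n) :
  measurable A -> lebesgue_rV n A = borel_lebesgue n A.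
Proof. by move=> mA; exact: measurable_mu_extE. Qed.

Lemma measurable_rV_lebesgue_id n :
  measurable_fun [set: rV_lebesgue n] (fun x : rV_lebesgue n => x : 'rV[R]_n).
Proof.
by move=> _ A mA; rewrite setTI; apply: sub_caratheodory;
  apply: sub_sigma_algebra.
Qed.

End rV_measure.

Section euclidean.
Context {R : realType} {n : nat}.
Implicit Types (x y : 'rV[R]_n) (f g phi : 'rV[R]_n -> R).

(* The library norm on 'rV[R]_n is the sup norm. *)
Definition enorm x : R := Num.sqrt (\sum_(i < n) x ord0 i ^+ 2).

Definition eball x (r : R) : set 'rV[R]_n := [set y | enorm (x - y) < r].

(* k times continuously differentiable: all partial derivatives of order at
   most k exist everywhere and are continuous. *)
Fixpoint Ck (k : nat) f : Prop :=
  continuous f /\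
  if k is k'.+1 then
    forall i : 'I_n, (forall x, derivable f x (delta_mx ord0 i)) /\
      Ck k' (fun x => 'D_(delta_mx ord0 i) f x)
  else True.

Definition Coo f : Prop := forall k, Ck k f.

Definition supp f : set 'rV[R]_n := closure [set x | f x != 0].

Definition Coo_c f : Prop := Coo f /\ compact (supp f).

Definition translate y f : 'rV[R]_n -> R := fun x => f (x - y).

Definition dilate (t : R) phi : 'rV[R]_n -> R :=
  fun x => t ^- n * phi (t^-1 *: x).

Definition convolution f g : 'rV[R]_n -> R :=
  fun x => (\int[lebesgue_rV n]_(y in [set: rV_lebesgue n])
              (f (x - (y : 'rV[R]_n)) * g y))%R.

End euclidean.

Section morrey.
Context {R : realType} {n : nat}.
Variables (p : \bar R) (w : R -> R).
Implicit Types f : 'rV[R]_n -> R.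

(* L^p(B) norm, computed by extending the restriction of f to B by zero. *)
Definition Lp_norm (B : set 'rV[R]_n) f : \bar R :=
  Lnorm (lebesgue_rV n) p (EFin \o (f \_ B) : rV_lebesgue n -> \bar R).

Definition morrey_norm f : \bar R :=
  ereal_sup [set ((w xr.2)%:E * Lp_norm (eball xr.1 xr.2) f)%E
            | xr in [set xr : 'rV[R]_n * R | 0 < xr.2]].

Definition morrey : set ('rV[R]_n -> R) :=
  [set f | measurable_fun [set: rV_lebesgue n] (f : rV_lebesgue n -> R) /\
           (morrey_norm f < +oo)%E].

(* [u t] tends to f in the Morrey space as t tends to the limit of F. *)
Definition morrey_cvg {T : Type} (F : set_system T)
    (u : T -> 'rV[R]_n -> R) f :=
  morrey_norm (u t \- f) @[t --> F] --> 0%E.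

Definition zorko : set ('rV[R]_n -> R) :=
  [set f | morrey f /\
           morrey_cvg (0 : 'rV[R]_n)^' (fun y => translate y f) f].

End morrey.

(* Main.v *)
(** Since phi_eps is supported in the ball of radius eps and has integral 1,
    f * phi_eps - f is the average of the differences tau_y f - f, |y| <= eps,
    against phi_eps.  Minkowski's integral inequality on each ball bounds its
    Morrey norm by ||phi||_1 times the supremum of ||tau_y f - f|| over
    |y| <= eps, which tends to 0 because f is in Zorko's subspace.  The same
    inequality applied to tau_y f, together with the translation invariance of
    the Morrey norm, bounds f * phi_eps.  As w r0 > 0, f is in L^p of every ball
    of radius r0, hence locally integrable, and in the integral of
    f y * phi_eps (x - y) all derivatives fall on phi_eps.

    For a merely Lebesgue measurable f, the function (x, y) |-> f (x - y) need
    not be measurable for the product of the Lebesgue sigma-algebras, so Tonelli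
    is not directly available: f is first replaced by a Borel function equal to
    it almost everywhere, which changes neither f * phi_eps at any point nor
    any Morrey norm. *)

Require Import Defs.
From mathcomp Require Import all_boot all_order all_algebra.
From mathcomp Require Import ring lra.
From mathcomp Require Import all_classical all_reals all_analysis.
From mathcomp Require Import measurable_realfun ess_sup_inf.

Set Implicit Arguments.
Unset Strict Implicit.
Unset Printing Implicit Defensive.

Import Order.TTheory GRing.Theory Num.Theory.
Import numFieldNormedType.Exports.

Local Open Scope classical_set_scope.
Local Open Scope ring_scope.

(** * Affine changes of variables *)

(** Bundles the right-hand side of a change of variables formula as a measure, so that the
    uniqueness theorems for Lebesgue and product measures apply to it. *)
Lemma scaled_pushforward d1 d2 (T1 : measurableType d1) (T2 : measurableType d2)
    (R : realType) (c : {nonneg R}) (mu : {measure set T1 -> \bar R})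
    (g : T1 -> T2) : measurable_fun setT g ->
  exists m : {measure set T2 -> \bar R},
    forall A, m A = (c%:num%:E * mu (g @^-1` A))%E.
Proof. by move=> mg; unshelve eexists (mscale c (pushforward mu g)). Qed.

Section affine.
Context {R : realType}.

Lemma measurable_affine (a b : R) :
  measurable_fun setT (fun s : measurableTypeR R => a * s + b : measurableTypeR R).
Proof.
by apply: measurable_funD => //; apply: measurable_funM.
Qed.

(** Both sides are measures in [A], so by uniqueness it suffices to compare them on the intervals
    []c, d]]. *)
Lemma lebesgue_measure_affine (a b : R) (A : set (measurableTypeR R)) :
  a != 0 -> measurable A ->
  lebesgue_measure A =
    (`|a|%:E * lebesgue_measure ((fun s => a * s + b)%R @^-1` A))%E.
Proof.
move=> a0 mA.
have [m mE] := scaled_pushforward `|a|%:nng (@lebesgue_measure R)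
  (measurable_affine a b).
rewrite -[RHS]mE; apply: lebesgue_measure_unique => // _ [[c d] _ <-].
rewrite mE lebesgue_measure_itv/= lte_fin.
have [a_gt0|a_lt0|] := ltgtP 0 a; last by move=> a00; rewrite -a00 eqxx in a0.
- have -> : (fun s => a * s + b) @^-1` `]c, d]%classic =
      `](c - b) / a, (d - b) / a]%classic.
    apply/seteqP; split => s /=; rewrite !in_itv/=;
      by rewrite ltr_pdivrMr// ler_pdivlMr// ltrBlDr lerBrDr (mulrC s).
  rewrite lebesgue_measure_itv/= lte_fin ltr_pM2r ?invr_gt0// ltrD2r.
  case: ifP => _; last by rewrite mule0.
  by rewrite -!EFinD -EFinM; congr (_%:E); rewrite (gtr0_norm a_gt0); field.
(* For [a < 0] the half-open interval is reversed and becomes closed on the left; its length is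
   unaffected. *)
- have -> : (fun s => a * s + b) @^-1` `]c, d]%classic =
      `[(d - b) / a, (c - b) / a[%classic.
    apply/seteqP; split => s /=; rewrite !in_itv/=;
    by rewrite ltr_ndivlMr// ler_ndivrMr// ltrBlDr lerBrDr (mulrC s) andbC.
  rewrite lebesgue_measure_itv/= lte_fin ltr_nM2r ?invr_lt0// ltrD2r.
  case: ifP => _; last by rewrite mule0.
  by rewrite -!EFinD -EFinM; congr (_%:E); rewrite (ltr0_norm a_lt0); field.
Qed.

Lemma measurable_rV_affine n (a : R) (b : 'rV[R]_n) :
  measurable_fun setT (fun v : 'rV[R]_n => a *: v + b).
Proof.
apply: measurable_fun_rVP => i.
rewrite (_ : (fun _ => _) = (fun s : measurableTypeR R => a * s + b ord0 i
    : measurableTypeR R) \o (fun v : 'rV[R]_n => v ord0 i)); last first.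
  by apply/funext => v /=; rewrite !mxE.
apply: measurableT_comp; first exact: measurable_affine.
exact: measurable_rV_coord.
Qed.

(* Translations, the reflection and the dilations are all of this form. *)
Lemma borel_lebesgue_affine n (a : R) (b : 'rV[R]_n) (A : set 'rV[R]_n) :
  a != 0 -> measurable A ->
  borel_lebesgue n A =
    ((`|a| ^+ n)%:E * borel_lebesgue n ((fun v => a *: v + b)%R @^-1` A))%E.
Proof.
move=> a0; elim: n b A => [|n IH] b A mA.
  rewrite expr0 mul1e; congr (borel_lebesgue 0 _).
  by apply/seteqP; split => v /=; rewrite [a *: v + b](_ : _ = v)//;
    apply/rowP => -[].
(* Through [rV_cons] the affine map becomes [T], which acts separately on the first coordinate and
   on the others, so uniqueness of the product measure reduces the claim to rectangles. *)
pose T (tv : measurableTypeR R * 'rV[R]_n) : measurableTypeR R * 'rV[R]_n :=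
  (a * tv.1 + b ord0 ord0, a *: tv.2 + rsubmx (b : 'rV[R]_(1 + n))).
have mT : measurable_fun setT T.
  apply/measurable_fun_pairP; split.
    by apply: (measurableT_comp (measurable_affine a _)).
  by apply: (measurableT_comp (measurable_rV_affine a _)).
have TE tv : a *: rV_cons tv + b = rV_cons (T tv).
  case: tv => t v; rewrite /rV_cons/=.
  apply/rowP => i; rewrite !mxE; case: splitP => j ij; rewrite !mxE ?(ord1 j)/=.
    rewrite mulr1n; congr (_ + b _ _).
    by apply/val_inj; rewrite /= ij (ord1 j).
  by congr (_ + b _ _); apply/val_inj.
have mC : measurable (@rV_cons R n @^-1` A).
  by rewrite -[X in measurable X]setTI; exact: measurable_rV_cons.
rewrite /=/rV_measureS/pushforward.
have -> : @rV_cons R n @^-1` ((fun v => a *: v + b) @^-1` A) =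
    T @^-1` (@rV_cons R n @^-1` A).
  by apply/seteqP; split => tv /=; rewrite TE.
set X := _ @^-1` A in mC *.
have an0 : 0 <= `|a| ^+ n.+1 by [].
have [m mE] := scaled_pushforward (NngNum an0)
  (@lebesgue_measure R \x borel_lebesgue n)%E mT.
rewrite -[RHS]mE; apply: product_measure_unique => // U V mU mV.
rewrite mE.
have -> : T @^-1` (U `*` V) = ((fun s => a * s + b ord0 ord0) @^-1` U) `*`
   ((fun v => a *: v + rsubmx (b : 'rV[R]_(1 + n))) @^-1` V) by [].
have mU' : measurable ((fun s => a * s + b ord0 ord0) @^-1` U).
  by rewrite -[X in measurable X]setTI; exact: measurable_affine.
have mV' : measurable
    ((fun v => a *: v + rsubmx (b : 'rV[R]_(1 + n))) @^-1` V).
  by rewrite -[X in measurable X]setTI; exact: measurable_rV_affine.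
apply: etrans (congr1 (fun z => (`|a| ^+ n.+1)%:E * z)%E
  (product_measure1E (@lebesgue_measure R) (borel_lebesgue n) mU' mV')) _.
apply/esym; apply: etrans (congr2 mule
  (lebesgue_measure_affine (b ord0 ord0) a0 mU)
  (IH (rsubmx (b : 'rV[R]_(1 + n))) V mV)) _.
by rewrite exprS EFinM muleACA.
Qed.

End affine.

(** * Integrals of Borel functions under affine maps *)

Section borel_integral.
Context {R : realType} (n : nat).
Local Notation mu := (@borel_lebesgue R n).

(** The identity from [rV_lebesgue n] to R^n is measurable and pushes [lebesgue_rV n] forward to
    [borel_lebesgue n]. *)
Lemma integral_lebesgue_rV (h : 'rV[R]_n -> \bar R) : measurable_fun setT h ->
  (\int[lebesgue_rV n]_(x in [set: rV_lebesgue n]) h x = \int[mu]_x h x)%E.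
Proof.
move=> mh.
have E (k : 'rV[R]_n -> \bar R) : measurable_fun setT k -> (forall x, 0 <= k x)%E ->
    (\int[lebesgue_rV n]_(x in [set: rV_lebesgue n]) k x = \int[mu]_x k x)%E.
  move=> mk k0.
  have := @ge0_integral_pushforward _ _ _ _ R _ (@measurable_rV_lebesgue_id R n)
    (lebesgue_rV n) setT k measurableT mk (fun x _ => k0 x).
  rewrite preimage_setT /= => <-.
  apply: eq_measure_integral => [|mid A mA _].
    exact: measurable_rV_lebesgue_id.
  exact: lebesgue_rV_borel.
rewrite integralE [RHS]integralE; congr (_ - _)%E; apply: E => //.
  exact: measurable_funepos.
exact: measurable_funeneg.
Qed.

Lemma integral_affine (a : R) (b : 'rV[R]_n) (h : 'rV[R]_n -> \bar R) :
  a != 0 -> measurable_fun setT h ->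
  (\int[mu]_x h x = (`|a| ^+ n)%:E * \int[mu]_x h (a *: x + b)%R)%E.
Proof.
move=> a0 mh.
have E (k : 'rV[R]_n -> \bar R) : measurable_fun setT k -> (forall x, 0 <= k x)%E ->
    (\int[mu]_x k x = (`|a| ^+ n)%:E * \int[mu]_x k (a *: x + b)%R)%E.
  move=> mk k0.
  have mT := measurable_rV_affine a b.
  have an0 : 0 <= `|a| ^+ n by [].
  have := @ge0_integral_pushforward _ _ _ _ R _ mT mu setT k measurableT mk
    (fun x _ => k0 x).
  rewrite preimage_setT => <-.
  have := @ge0_integral_mscale _ _ R (pushforward mu (fun x => a *: x + b)%R)
    setT measurableT (NngNum an0) k mk (fun x _ => k0 x).
  move=> /(_ mT) <-.
  apply: eq_measure_integral => A mA _; exact: (borel_lebesgue_affine b a0 mA).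
rewrite integralE (E (h^\+)%E)//; last exact: measurable_funepos.
rewrite (E (h^\-)%E)//; last exact: measurable_funeneg.
rewrite [X in _ = (_ * X)%E]integralE.
(* Both parts of [h] may have infinite integral, so the positive factor is moved across the extended
   difference by cases. *)
suff D (c : R) (u v : \bar R) : 0 < c -> (c%:E * u - c%:E * v = c%:E * (u - v))%E.
  rewrite -[RHS]D ?exprn_gt0 ?normr_gt0//.
  by congr (_ * _ - _ * _)%E; apply: eq_integral => x _;
    rewrite ?funeposE ?funenegE.
move=> c0; case: u => [u| |]; case: v => [v| |];
  do ?[rewrite gt0_muley ?lte_fin//|rewrite gt0_muleNy ?lte_fin//].
exact: (congr1 EFin (esym (mulrBr c u v))).
Qed.
End borel_integral.

(** * Borel sets of R^n *)

Section borel_rV.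
Context {R : realType} (n : nat).
Local Notation mu := (@borel_lebesgue R n).

Lemma rV_coord_norm (v : 'rV[R]_n) i : `|v ord0 i| <= `|v|.
Proof.
have /mapP[j Hj ->] : `|v ord0 i| \in [seq `|v x.1 x.2| | x : 'I_1 * 'I_n].
  by apply/mapP; exists (ord0, i) => //=; rewrite mem_enum.
by rewrite [leRHS]/Num.norm /= mx_normrE; apply/bigmax_geP; right => /=; exists j.
Qed.

Lemma rV_norm_lt (v : 'rV[R]_n) (e : R) : 0 < e ->
  (forall i, `|v ord0 i| < e) -> `|v| < e.
Proof.
move=> e0 ve; rewrite [ltLHS]/Num.norm /= mx_normrE.
by apply/bigmax_ltP; split => // -[i j] _ /=; rewrite (ord1 i).
Qed.

Lemma rV_norm_le (v : 'rV[R]_n) (e : R) : 0 <= e ->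
  (forall i, `|v ord0 i| <= e) -> `|v| <= e.
Proof.
move=> e0 ve; rewrite [leLHS]/Num.norm /= mx_normrE.
by apply/bigmax_leP; split => // -[i j] _ /=; rewrite (ord1 i).
Qed.

Lemma measurable_rV_box (F : 'I_n -> set (measurableTypeR R)) :
  (forall i, measurable (F i)) ->
  measurable [set v : 'rV[R]_n | forall i, F i (v ord0 i)].
Proof.
move=> mF; rewrite (_ : [set v | _] = \bigcap_(i in setT)
    ((fun v : 'rV[R]_n => v ord0 i : measurableTypeR R) @^-1` F i)).
  apply: fin_bigcap_measurable => // i _.
  rewrite -[X in measurable X]setTI.
  exact: (@measurable_rV_coord _ n i measurableT _ (mF _)).
by apply/seteqP; split => v /= H i; [move=> _; exact: H|exact: H].
Qed.

(** The boxes with rational centre and half-side [1 / (k + 1)] are countably many, and [U] is the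
    union of those it contains. *)
Lemma open_measurable_rV (U : set 'rV[R]_n) : open U -> measurable U.
Proof.
move=> oU.
pose B (ck : 'rV[rat]_n * nat) : set 'rV[R]_n :=
  [set v | forall i, `]ratr (ck.1 ord0 i) - ck.2.+1%:R^-1,
                       ratr (ck.1 ord0 i) + ck.2.+1%:R^-1[%classic (v ord0 i)].
have -> : U = \bigcup_ck (if `[< B ck `<=` U >] then B ck else set0).
  apply/seteqP; split => [v Uv|v [ck _]]; last by case: ifPn => // /asboolP; exact.
  have /nbhs_ballP[e /= e0 eU] := open_nbhs_nbhs (conj oU Uv).
  (* Coordinates of two points of a box differ by less than twice the half-side, whence the factor
     2. *)
  have [k ke] : exists k, 2 * k.+1%:R^-1 < e.
    have [|k] := @ltr_add_invr R 0 (e / 2); first by rewrite divr_gt0.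
    by rewrite add0r => ke; exists k; rewrite mulrC -ltr_pdivlMr.
  have c_ i : {q : rat | ratr q \in `]v ord0 i - k.+1%:R^-1, v ord0 i + k.+1%:R^-1[}.
    by apply/cid/rat_in_itvoo; rewrite ltrBlDr -addrA ltrDl addr_gt0.
  exists (\row_i sval (c_ i), k) => //.
  have Bv : B (\row_i sval (c_ i), k) v.
    move=> i /=; rewrite mxE; case: (c_ i) => q /=; rewrite !in_itv/= => /andP[h1 h2].
    by rewrite ltrBlDr h2/= -ltrBlDr h1.
  case: ifPn => // /asboolPn; apply => w Bw; apply: eU.
  rewrite mx_norm_ball /ball_/=; apply: rV_norm_lt => // i.
  apply: lt_trans ke; rewrite !mxE.
  have := Bv i; have := Bw i; rewrite /=!in_itv/=.
  set x := v ord0 i; set y := w ord0 i; set c := ratr _; set d := _^-1.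
  by move=> /andP[? ?] /andP[? ?]; rewrite ltr_norml; lra.
apply: countable_bigcupT_measurable => [|ck]; first exact: countableP.
case: ifPn => // _.
apply: (@measurable_rV_box (fun i => `]ratr (ck.1 ord0 i) - ck.2.+1%:R^-1,
  ratr (ck.1 ord0 i) + ck.2.+1%:R^-1[%classic)) => i.
exact: measurable_itv.
Qed.

Lemma continuous_measurable_rV (f : 'rV[R]_n -> R) :
  continuous f -> measurable_fun setT (f : 'rV[R]_n -> measurableTypeR R).
Proof.
move=> cf; apply: (measurability _ (RGenOpens.measurableE R)).
move=> _ [_ [a [b ->]] <-]; rewrite setTI; apply: open_measurable_rV.
by move/continuousP: cf; apply; exact: interval_open.
Qed.

Lemma measurable_norm_le (r : R) : measurable [set v : 'rV[R]_n | `|v| <= r].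
Proof.
rewrite (_ : [set v | _] = (fun v : 'rV[R]_n => `|v|) @^-1` `]-oo, r]%classic); last first.
  by apply/seteqP; split => v /=; rewrite in_itv.
rewrite -[X in measurable X]setTI; apply: continuous_measurable_rV => //.
exact: norm_continuous.
Qed.

Lemma borel_lebesgue_norm_le (r : R) :
  (mu [set v : 'rV[R]_n | `|v| <= r]%R < +oo)%E.
Proof.
apply: (@le_lt_trans _ _ (mu [set v | forall i, `[- `|r|, `|r|]%classic (v ord0 i)]%R)).
  apply: le_measure; rewrite ?inE; first exact: measurable_norm_le.
    apply: (@measurable_rV_box (fun=> `[- `|r|, `|r|]%classic)) => i.
    exact: measurable_itv.
  move=> v /= vr i; rewrite in_itv/= -ler_norml.
  by rewrite (le_trans (rV_coord_norm _ _))// (le_trans vr)// ler_norm.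
rewrite (@borel_lebesgue_box _ _ (fun=> `[- `|r|, `|r|]%classic)) => [|i];
  last exact: measurable_itv.
rewrite (eq_bigr (fun=> (`|r| + `|r|)%:E)) ?prodEFin ?ltry// => i _.
rewrite lebesgue_measure_itv/= lte_fin; case: ifPn => [_|].
  by rewrite -EFinD opprK.
by rewrite -leNgt => r0; congr EFin; have := normr_ge0 r; lra.
Qed.

Lemma measurable_fun_enorm : measurable_fun setT (@enorm R n).
Proof.
apply: (@measurableT_comp _ _ _ _ _ _ (@Num.sqrt R)).
  by apply: continuous_measurable_fun; exact: sqrt_continuous.
apply: measurable_sum => i; apply: measurable_funX.
exact: measurable_rV_coord.
Qed.

Lemma measurable_eball (x : 'rV[R]_n) (r : R) : measurable (eball x r).
Proof.
rewrite (_ : eball x r = (@enorm R n \o (fun v => -1 *: v + x)) @^-1` `]-oo, r[%classic).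
  rewrite -[X in measurable X]setTI; apply: (measurableT_comp measurable_fun_enorm) => //.
  exact: measurable_rV_affine.
by apply/seteqP; split => v /=; rewrite in_itv/= scaleN1r addrC.
Qed.

Lemma enorm_le_norm (v : 'rV[R]_n) : enorm v <= Num.sqrt n%:R * `|v|.
Proof.
rewrite -{1}(ger0_norm (normr_ge0 v)) -sqrtr_sqr -sqrtrM ?ler0n// ler_wsqrtr//.
rewrite mulr_natl.
have -> : `|v| ^+ 2 *+ n = \sum_(i < n) `|v| ^+ 2 by rewrite sumr_const card_ord.
rewrite ler_sum// => i _.
by rewrite -(ger0_norm (sqr_ge0 (v ord0 i))) normrX lerXn2r ?nnegrE// rV_coord_norm.
Qed.

Lemma norm_le_enorm (v : 'rV[R]_n) : `|v| <= enorm v.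
Proof.
apply: rV_norm_le => [|i]; first exact: sqrtr_ge0.
rewrite -sqrtr_sqr ler_wsqrtr// (bigD1 i)//= lerDl sumr_ge0// => j _.
exact: sqr_ge0.
Qed.

End borel_rV.

(** * Borel modifications of Lebesgue measurable functions *)

Section hull.
Local Open Scope ereal_scope.
Local Open Scope measure_scope.
Context d (T : measurableType d) (R : realType) (mu : {measure set T -> \bar R}).

(** For each [k] some countable measurable cover of [X] has total mass within [1 / (k + 1)] of the
    outer measure; [G] is the intersection over [k] of their unions. *)
Lemma measurable_hull (X : set T) : mu^* X < +oo ->
  exists G, [/\ measurable G, X `<=` G & mu G = mu^* X].
Proof.
move=> Xoo.
have Xfin : mu^* X \is a fin_num by rewrite ge0_fin_numE//; exact: mu_ext_ge0.
have H (k : nat) : {F : (set T)^nat | measurable_cover X F /\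
    \sum_(i <oo) mu (F i) < mu^* X + (k.+1%:R^-1)%:E}.
  apply/cid; have k0 : (0 < k.+1%:R^-1 :> R)%R by [].
  by have [_ [F cF <-] ?] := lb_ereal_inf_adherent k0 Xfin; exists F.
pose F k := sval (H k).
pose G := \bigcap_k \bigcup_i F k i.
have mF k i : measurable (F k i) by rewrite /F; case: (H k) => ? [[+ _] _]/=; exact.
have mG : measurable G by apply: bigcapT_measurable => k; exact: bigcupT_measurable.
have XG : X `<=` G.
  by move=> x Xx k _; rewrite /F; case: (H k) => ? [[_ +] _]/=; exact.
exists G; split => //; apply/eqP; rewrite eq_le; apply/andP; split; last first.
  by rewrite -(measurable_mu_extE mu mG); exact: le_mu_ext.
apply/lee_addgt0Pr => e e0.
have [k ke] := ltr_add_invr e0; rewrite add0r in ke.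
apply: (@le_trans _ _ (mu^* X + (k.+1%:R^-1)%:E)); last by rewrite leeD2l// lee_fin ltW.
have [_ /ltW] := svalP (H k); apply: le_trans.
rewrite -(measurable_mu_extE mu mG); apply: ereal_inf_lbound.
by exists (F k) => //; split => // x /(_ k I).
Qed.

End hull.

Section borel_modification.
Context {R : realType} (n : nat).
Local Notation mu := (@borel_lebesgue R n).

(* Unlike the almost everywhere filter of [lebesgue_rV n], the exceptional set
   is Borel, so that its affine preimages are measurable for the same reason. *)
Definition ae_borel (T : Type) (f f' : 'rV[R]_n -> T) :=
  exists N, [/\ measurable N, mu N = 0%E & forall x, ~ N x -> f x = f' x].

Lemma null_bigcup (F : (set 'rV[R]_n)^nat) :
  (forall k, measurable (F k) /\ mu (F k) = 0%E) -> mu (\bigcup_k F k) = 0%E.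
Proof.
move=> H; apply/negligibleP.
  by apply: bigcupT_measurable => k; exact: (H k).1.
by apply: negligible_bigcup => k; apply/negligibleP; [exact: (H k).1|exact: (H k).2].
Qed.

Lemma lebesgue_null_sub (N A : set 'rV[R]_n) : measurable N -> mu N = 0%E ->
  A `<=` N -> measurable (A : set (rV_lebesgue n)).
Proof.
move=> mN N0 AN; apply: (@measure_is_complete_caratheodory R _ (mu^*)%mu).
exists N; split => //=.
  by apply: sub_caratheodory; apply: sub_sigma_algebra.
by apply: etrans N0; exact: measurable_mu_extE.
Qed.

(** On a ball [S k] outer measures are finite: [A] cut down to [S k] has a Borel hull [G] of the
    same measure, the excess is null, and a Borel hull [N] of the excess is the exceptional set. The
    balls exhaust R^n. *)
Lemma lebesgue_borel_set (A : set (rV_lebesgue n)) : measurable A ->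
  exists B N : set 'rV[R]_n, [/\ measurable B, measurable N, mu N = 0%E &
    A `\` N = B `\` N].
Proof.
move=> mA.
pose S k := [set v : 'rV[R]_n | `|v| <= k%:R].
have mS k : measurable (S k) by exact: measurable_norm_le.
have mSL k : measurable (S k : set (rV_lebesgue n)).
  by apply: sub_caratheodory; apply: sub_sigma_algebra; exact: mS.
have H k : {GN : set 'rV[R]_n * set 'rV[R]_n | [/\ measurable GN.1, measurable GN.2,
    mu GN.2 = 0%E & (A `&` S k) `\` GN.2 = GN.1 `\` GN.2]}.
  apply/cid.
  have mAS : measurable (A `&` S k : set (rV_lebesgue n)) by exact: measurableI.
  have ASoo : ((mu^*)%mu (A `&` S k) < +oo)%E.
    apply: (@le_lt_trans _ _ ((mu^*)%mu (S k))); first by apply: le_mu_ext; exact: subIsetr.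
    by rewrite measurable_mu_extE//; exact: borel_lebesgue_norm_le.
  have [G [mG ASG GE]] := measurable_hull ASoo.
  have mGL : measurable (G : set (rV_lebesgue n)).
    by apply: sub_caratheodory; apply: sub_sigma_algebra.
  have D0 : lebesgue_rV n (G `\` (A `&` S k)) = 0%E.
    have GL : lebesgue_rV n G = (mu^*)%mu (A `&` S k).
      by rewrite -GE; exact: lebesgue_rV_borel.
    have Goo : (lebesgue_rV n G < +oo)%E by rewrite GL.
    apply: etrans (measureD mGL mAS Goo) _.
    rewrite (_ : G `&` (A `&` S k) = A `&` S k); last by apply/setIidPr.
    apply: etrans (congr1 (fun z => z - (mu^*)%mu (A `&` S k))%E GL) _.
    by apply: subee; rewrite ge0_fin_numE//; exact: mu_ext_ge0.
  have Doo : ((mu^*)%mu (G `\` (A `&` S k)) < +oo)%E by rewrite [X in (X < _)%E]D0.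
  have [N [mN GN NE]] := measurable_hull Doo.
  exists (G, N); split => //=; first by rewrite NE.
  apply/seteqP; split => x [xA xN]; split => //; first exact: ASG.
  by apply: contrapT => nA; apply: xN; exact: GN.
pose G k := (sval (H k)).1; pose N k := (sval (H k)).2.
have mN : measurable (\bigcup_k N k).
  by apply: bigcupT_measurable => k; rewrite /N; case: (H k) => ? [].
exists (\bigcup_k G k), (\bigcup_k N k); split => //.
- by apply: bigcupT_measurable => k; rewrite /G; case: (H k) => ? [].
- by apply: null_bigcup => k; rewrite /N; case: (H k) => ? [].
have E k : (A `&` S k) `\` N k = G k `\` N k by rewrite /G /N; case: (H k) => ? [].
apply/seteqP; split => x [xA xN]; split => //.
- pose k := Num.bound `|x|; exists k => //.
  suff [] : (G k `\` N k) x by [].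
  rewrite -E; split; last by move=> Nx; apply: xN; exists k.
  split => //; rewrite /S/=; apply: ltW.
  exact: (archi_boundP (normr_ge0 x)).
- case: xA => k _ Gk.
  suff [[]] : ((A `&` S k) `\` N k) x by [].
  by rewrite E; split => // Nx; apply: xN; exists k.
Qed.

(** The sublevel sets at rational heights determine [f]. Each is Borel off a Borel null set, and
    [f'] is [f] set to 0 on the countable union [N] of these null sets. *)
Lemma borel_modification (f : 'rV[R]_n -> R) :
  measurable_fun [set: rV_lebesgue n] (f : rV_lebesgue n -> R) ->
  exists2 f' : 'rV[R]_n -> R, measurable_fun setT f' & ae_borel f f'.
Proof.
move=> mf.
(* [q] runs through all rationals; indices that decode to nothing yield the harmless repetition
   0. *)
pose q k : R := ratr (odflt 0 (unpickle k) : rat).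
have H k : {BN : set 'rV[R]_n * set 'rV[R]_n | [/\ measurable BN.1, measurable BN.2,
    mu BN.2 = 0%E & f @^-1` `]-oo, q k[%classic `\` BN.2 = BN.1 `\` BN.2]}.
  apply/cid; have mY : measurable (`]-oo, q k[%classic : set R) by exact: measurable_itv.
  have := mf measurableT _ mY; rewrite setTI => /lebesgue_borel_set[B [N [*]]].
  by exists (B, N).
pose B k := (sval (H k)).1; pose N_ k := (sval (H k)).2.
pose N := \bigcup_k N_ k.
have mB k : measurable (B k) by rewrite /B; case: (H k) => ? [].
have mN : measurable N.
  by apply: bigcupT_measurable => k; rewrite /N_; case: (H k) => ? [].
have N0 : mu N = 0%E.
  by apply: null_bigcup => k; rewrite /N_; case: (H k) => ? [].
have E k x : ~ N x -> (f x < q k) <-> B k x.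
  move=> Nx; have Nk : ~ N_ k x by move=> ?; apply: Nx; exists k.
  have /seteqP[S1 S2] : f @^-1` `]-oo, q k[%classic `\` N_ k = B k `\` N_ k.
    by rewrite /B /N_; case: (H k) => ? [].
  split=> Hx.
    by have [] := S1 x (conj _ Nk); rewrite /= ?in_itv.
  by have [] := S2 x (conj Hx Nk); rewrite /= in_itv.
exists (fun x => if x \in N then 0 else f x); last first.
  by exists N; split => // x Nx; rewrite memNset.
apply: (measurability _ (RGenInftyO.measurableE R)).
move=> _ [_ [c ->] <-]; rewrite setTI.
(* As [f'] is 0 on [N], the set [N] lies in the sublevel set at height [c] exactly when [0 < c]; off
   [N], a rational between [f x] and [c] selects the index [k]. *)
rewrite (_ : _ @^-1` _ = (if 0 < c then N else set0) `|`
    \bigcup_k (if q k < c then B k `\` N else set0)).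
  apply: measurableU; first by case: ifPn.
  by apply: bigcupT_measurable => k; case: ifPn => // _; exact: measurableD.
apply/seteqP; split => x /=; rewrite in_itv/=.
  case: ifPn => [/set_mem Nx c0|/negP Nx fc]; first by left; rewrite c0.
  right; have [r /andP[fr rc]] := rat_in_itvoo fc.
  have nNx : ~ N x by move=> Nx'; apply: Nx; rewrite inE.
  exists (pickle r) => //; have qr : q (pickle r) = ratr r by rewrite /q pickleK.
  by rewrite qr ifT//; split => //; apply/E => //; rewrite qr.
case.
  by case: ifPn => // c0 Nx; rewrite mem_set.
case=> k _; case: ifPn => // qc [Bx Nx]; rewrite memNset//.
by apply: lt_trans qc; apply/E.
Qed.

(** A preimage under [f] is a Borel set off [N] together with a subset of [N], which is measurable
    by completeness. *)
Lemma ae_borel_measurable (f f' : 'rV[R]_n -> R) :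
  measurable_fun setT f' -> ae_borel f f' ->
  measurable_fun [set: rV_lebesgue n] (f : rV_lebesgue n -> R).
Proof.
move=> mf' [N [mN N0 ff']] _ Y mY; rewrite setTI.
have -> : f @^-1` Y = (f' @^-1` Y `\` N) `|` (f @^-1` Y `&` N).
  apply/seteqP; split => x /=.
    by have [Nx|Nx] := pselect (N x); [right|left; rewrite -ff'].
  by move=> [[+ Nx]|[]//]; rewrite -ff'.
apply: measurableU.
  apply: sub_caratheodory; apply: sub_sigma_algebra; apply: measurableD => //.
  by rewrite -[X in measurable X]setTI; exact: mf'.
by apply: (lebesgue_null_sub mN N0); exact: subIsetr.
Qed.

Lemma ae_borel_ae (T : Type) (f f' : 'rV[R]_n -> T) : ae_borel f f' ->
  {ae lebesgue_rV n, forall x : rV_lebesgue n, f x = f' x}.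
Proof.
move=> [N [mN N0 ff']]; exists N; split => //.
- by apply: sub_caratheodory; apply: sub_sigma_algebra.
- by apply: etrans N0; exact: lebesgue_rV_borel.
- by move=> x /= H; apply: contrapT => Nx; apply: H; exact: ff'.
Qed.

Lemma ae_borel_Rintegral (f f' : 'rV[R]_n -> R) :
  measurable_fun setT f' -> ae_borel f f' ->
  \int[lebesgue_rV n]_(x in [set: rV_lebesgue n]) f x = \int[mu]_x f' x.
Proof.
move=> mf' ff'; rewrite /Rintegral; congr fine.
rewrite (@ae_eq_integral _ _ _ (lebesgue_rV n) _ (EFin \o f')) //.
- by apply: (@integral_lebesgue_rV _ _ (EFin \o f')); exact/measurable_EFinP.
- by apply/measurable_EFinP; exact: ae_borel_measurable ff'.
- apply/measurable_EFinP; apply: (ae_borel_measurable mf').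
  by exists set0; split.
- by apply: filterS (ae_borel_ae ff') => x /= ->.
Qed.

Lemma ae_borel_affine (T : Type) (a : R) (b : 'rV[R]_n) (f f' : 'rV[R]_n -> T) :
  a != 0 -> ae_borel f f' ->
  ae_borel (fun x => f (a *: x + b)) (fun x => f' (a *: x + b)).
Proof.
move=> a0 [N [mN N0 ff']].
exists ((fun x => a *: x + b) @^-1` N); split => [||x]; last exact: ff'.
  by rewrite -[X in measurable X]setTI; exact: measurable_rV_affine.
have := borel_lebesgue_affine b a0 mN; rewrite N0 => /esym/eqP.
rewrite mule_eq0 => /orP[|/eqP//].
by rewrite eqe expf_eq0 normr_eq0 (negbTE a0) andbF.
Qed.

Lemma ae_borel_op (T1 T2 T : Type) (op : T1 -> T2 -> T)
    (f f' : 'rV[R]_n -> T1) (g g' : 'rV[R]_n -> T2) :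
  ae_borel f f' -> ae_borel g g' ->
  ae_borel (fun x => op (f x) (g x)) (fun x => op (f' x) (g' x)).
Proof.
move=> [N [mN N0 ff']] [M [mM M0 gg']]; exists (N `|` M); split.
- exact: measurableU.
- by apply/eqP; rewrite eq_le measure_ge0 andbT -(adde0 0%E) -[X in (_ <= X + _)%E]N0
    -[X in (_ <= _ + X)%E]M0; exact: measureU2.
- by move=> x /not_orP[Nx Mx]; rewrite ff'// gg'.
Qed.

Lemma ae_borel_refl (T : Type) (f : 'rV[R]_n -> T) : ae_borel f f.
Proof. by exists set0; split. Qed.

Lemma Lp_norm_borel (p : \bar R) (B : set 'rV[R]_n) (f f' : 'rV[R]_n -> R) :
  (1 <= p)%E -> measurable B -> measurable_fun setT f' -> ae_borel f f' ->
  Lp_norm p B f = Lnorm mu p (EFin \o (f' \_ B)).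
Proof.
move=> p1 mB mf' ff'.
have mg : measurable_fun setT (f' \_ B) 
  by apply/(measurable_restrictT _ mB); exact: measurable_funTS.
have gg' : ae_borel (f \_ B) (f' \_ B).
  case: ff' => N [mN N0 E]; exists N; split => // x Nx.
  by rewrite /patch; case: ifPn => // _; exact: E.
rewrite /Lp_norm; move: mg gg'; move: (f \_ B) (f' \_ B) => g g' mg gg'.
have mgL := ae_borel_measurable mg gg'.
have mgL' := ae_borel_measurable mg (ae_borel_refl g').
have aeg := ae_borel_ae gg'.
rewrite unlock; case: p p1 => [p||//] p1 /=.
- congr (_ `^ _)%E.
  have mpow : measurable_fun setT (fun x : \bar R => `|x| `^ p)%E.
    by apply: (measurableT_comp (measurable_poweR _)); exact: abse_measurable.
  have mcomp d' (T' : measurableType d') (k : T' -> R) : measurable_fun setT k ->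
      measurable_fun setT (fun x => `|(k x)%:E| `^ p)%E.
    move=> mk; apply: (@measurableT_comp _ _ _ _ _ _ (fun x : \bar R => `|x| `^ p)%E) => //.
    exact/measurable_EFinP.
  rewrite (@ae_eq_integral _ _ _ (lebesgue_rV n) _ (fun x => `|(g' x)%:E| `^ p)%E)//.
  + apply: (@integral_lebesgue_rV _ _ (fun x => `|(g' x)%:E| `^ p)%E).
    exact: mcomp.
  + exact: mcomp.
  + exact: mcomp.
  + by apply: filterS aeg => x /= ->.
- have -> : lebesgue_rV n [set: rV_lebesgue n] = mu setT by exact: lebesgue_rV_borel.
  case: ifPn => // _.
  rewrite (@eq_ess_sup _ _ _ (lebesgue_rV n) _ (abse \o (EFin \o g'))); last first.
    by apply: filterS aeg => x /= ->.
  rewrite /ess_sup; congr ereal_inf; apply/seteqP.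
  (* The superlevel sets of [g'] are Borel, so both measures agree on them and both essential
     suprema have the same upper bounds. *)
  have H y : measurable ((abse \o (EFin \o g') : 'rV[R]_n -> _) @^-1` `]y, +oo[).
    rewrite -[X in measurable X]setTI; apply: measurableT_comp => //.
      exact/measurable_EFinP.
    exact: emeasurable_itv.
  have K y : (\forall x \ae lebesgue_rV n, (`|(g' x)%:E| <= y)%E) <->
      (\forall x \ae mu, (`|(g' x)%:E| <= y)%E).
    rewrite (@ae_le_measureP _ _ _ (lebesgue_rV n)); last first.
      by apply: measurableT_comp => //; exact/measurable_EFinP.
    rewrite (@ae_le_measureP _ _ _ mu); last first.
      by apply: measurableT_comp => //; exact/measurable_EFinP.
    by split; apply: etrans; [apply/esym|]; exact: lebesgue_rV_borel (H y).
  by split => y /= /K.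
Qed.

End borel_modification.

(** * Minkowski's integral inequality *)

Section minkowski.
Context {R : realType}.

Lemma ge0_le_poweR (r : R) (x y : \bar R) :
  0 <= r -> (0 <= x)%E -> (x <= y)%E -> (x `^ r <= y `^ r)%E.
Proof.
move=> r0 x0 xy; apply: gt0_ler_poweR => //; rewrite in_itv/= leey andbT//.
exact: le_trans xy.
Qed.

(** Jensen's inequality for the measure of density [k]; since [k] has total mass [C] rather than 1,
    the factor [C ^ (r - 1)] appears. *)
Lemma integral_weight_poweR d (T : measurableType d)
    (mu : {measure set T -> \bar R}) (h k : T -> R) (C r : R) :
  measurable_fun setT h -> measurable_fun setT k -> (forall x, 0 <= k x) ->
  (\int[mu]_x (k x)%:E = C%:E)%E -> 1 <= r ->
  ((\int[mu]_x (`|h x| * k x)%:E) `^ r <=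
    (C `^ (r - 1))%:E * \int[mu]_x (`|h x| `^ r * k x)%:E)%E.
Proof.
(* At [r = 1] both sides coincide; this case is split off because the conjugate exponent
   [r / (r - 1)] used below requires [r > 1]. *)
move=> mh mk k0 kC; rewrite le_eqVlt => /predU1P[<-|r1].
  rewrite subrr powRr0 mul1e poweRe1; last first.
    by apply: integral_ge0 => x _; rewrite lee_fin mulr_ge0.
  by under [leRHS]eq_integral do rewrite powRr1//.
have r0 : 0 < r by rewrite (lt_trans _ r1).
have rB1 : 0 < r - 1 by rewrite subr_gt0.
have rN0 : r != 0 by rewrite gt_eqF.
have rBN0 : r - 1 != 0 by rewrite gt_eqF.
pose q := r / (r - 1).
have q0 : 0 < q by rewrite divr_gt0.
have qN0 : q != 0 by rewrite gt_eqF.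
have rq : r^-1 + q^-1 = 1 by rewrite /q; field; rewrite rBN0 rN0.
pose a x := `|h x| * k x `^ r^-1; pose b x := k x `^ q^-1.
have mp s : measurable_fun setT (fun x => k x `^ s).
  by apply: (@measurableT_comp _ _ _ _ _ _ (@powR R ^~ s)) => //; exact: measurable_powR.
have ma : measurable_fun setT a.
  by apply: measurable_funM => //; apply: measurableT_comp.
have := @hoelder _ _ _ mu a b r q ma (mp _) r0 q0 rq.
rewrite Lnorm1.
under eq_integral => x _.
  rewrite /= /a /b -mulrA -powRD ?rq ?oner_eq0// powRr1// ger0_norm ?mulr_ge0//; over.
move=> H.
have rnn : 0 <= r by exact: ltW.
(* Hoelder for [|h| k^(1/r)] and [k^(1/q)], raised to the power [r] *)
apply: (@le_trans _ _ (('N[mu]_r%:E[EFin \o a] * 'N[mu]_q%:E[EFin \o b]) `^ r)%E).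
  apply: ge0_le_poweR => //; apply: integral_ge0 => x _.
  by rewrite lee_fin mulr_ge0.
rewrite poweRM ?Lnorm_ge0// poweR_Lnorm// muleC.
have -> : ('N[mu]_q%:E[EFin \o b] `^ r = (C `^ (r - 1))%:E)%E.
  have {1}-> : r = q * (r - 1) by rewrite /q divfK.
  rewrite poweRrM poweR_Lnorm// -poweR_EFin -kC; congr (_ `^ _)%E.
  apply: eq_integral => x _ /=; congr EFin.
  by rewrite /b ger0_norm ?powR_ge0// -powRrM mulVf// powRr1.
rewrite le_eqVlt; apply/orP; left; apply/eqP; congr (_ * _)%E.
apply: eq_integral => x _ /=; congr EFin.
rewrite /a ger0_norm ?mulr_ge0 ?powR_ge0// powRM ?powR_ge0// -powRrM mulVf//.
by rewrite powRr1.
Qed.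

(** For finite [p], Jensen's inequality in [y] and Tonelli reduce the bound to the sections of [F];
    for infinite [p], Tonelli exchanges the almost everywhere bounds. Sections are controlled only
    where [k] is nonzero, so that later only translations in the support of the mollifier matter. *)
Lemma Lnorm_integral_le d1 d2 (T1 : measurableType d1) (T2 : measurableType d2)
    (m1 : {sigma_finite_measure set T1 -> \bar R})
    (m2 : {sigma_finite_measure set T2 -> \bar R})
    (p : \bar R) (F : T1 * T2 -> R) (k : T2 -> R) (G : T1 -> R) (C M : R) :
  (1 <= p)%E -> measurable_fun setT F -> measurable_fun setT k ->
  (forall y, 0 <= k y) -> measurable_fun setT G ->
  (\int[m2]_y (k y)%:E = C%:E)%E -> 0 <= M ->
  (forall y, k y != 0 -> (Lnorm m1 p (fun x => (F (x, y))%:E) <= M%:E)%E) ->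
  (forall x, (`|G x|%:E <= \int[m2]_y (`|F (x, y)| * k y)%:E)%E) ->
  ('N[m1]_p[EFin \o G] <= (C * M)%:E)%E.
Proof.
move=> p1 mF mk k0 mG kC M0 FM GF.
have C0 : 0 <= C by rewrite -lee_fin -kC; apply: integral_ge0 => y _; rewrite lee_fin.
have mF1 x : measurable_fun setT (fun y => F (x, y)).
  by apply: (measurableT_comp mF); exact: measurable_pair1.
have mF2 y : measurable_fun setT (fun x => F (x, y)).
  by apply: (measurableT_comp mF); exact: measurable_pair2.
have mk2 : measurable_fun [set: T1 * T2] (fun z => k z.2).
  exact: (measurableT_comp mk measurable_snd).
case: p p1 FM => [r||//] p1 FM.
- rewrite lee_fin in p1.
  have r0 : 0 < r by rewrite (lt_le_trans _ p1).
  have rN0 : r != 0 by rewrite gt_eqF.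
  have rnn : 0 <= r by exact: ltW.
  have powm d (T : measurableType d) (h : T -> R) : measurable_fun setT h ->
      measurable_fun setT (fun x => `|h x| `^ r).
    by move=> mh; apply: (@measurableT_comp _ _ _ _ _ _ (@powR R ^~ r));
      [exact: measurable_powR|exact: measurableT_comp].
  have mH : measurable_fun setT (fun z : T1 * T2 => (`|F z| `^ r * k z.2)%:E).
    by apply/measurable_EFinP; apply: measurable_funM => //; exact: powm.
  have H0 (z : T1 * T2) : (0 <= (`|F z| `^ r * k z.2)%:E)%E.
    by rewrite lee_fin mulr_ge0// powR_ge0.
  suff H : ('N[m1]_r%:E[EFin \o G] `^ r <= ((C * M) `^ r)%:E)%E.
    have rVnn : 0 <= r^-1 by rewrite invr_ge0.
    have := ge0_le_poweR rVnn (poweR_ge0 _ _) H.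
    rewrite -poweRrM divff// poweRe1 ?Lnorm_ge0// poweR_EFin -powRrM divff//.
    by rewrite powRr1// mulr_ge0.
  rewrite poweR_Lnorm//.
  apply: (@le_trans _ _ (\int[m1]_x ((C `^ (r - 1))%:E *
      \int[m2]_y (`|F (x, y)| `^ r * k y)%:E))%E).
    apply: ge0_le_integral => //.
    + by move=> x _; exact: poweR_ge0.
    + by apply/measurable_EFinP; exact: powm.
    + apply: emeasurable_funM => //.
      exact: (measurable_fun_fubini_tonelli_F
      (fun z : T1 * T2 => (`|F z| `^ r * k z.2)%:E)).
    + move=> x _ /=.
      apply: le_trans (integral_weight_poweR (mF1 x) mk k0 kC p1).
      by apply: (@ge0_le_poweR r `|G x|%:E) => //; rewrite lee_fin.
  rewrite ge0_integralZl//; last 3 first.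
  - exact: (measurable_fun_fubini_tonelli_F
      (fun z : T1 * T2 => (`|F z| `^ r * k z.2)%:E)).
  - by move=> x _; apply: integral_ge0 => y _; exact: (H0 (x, y)).
  - by rewrite lee_fin powR_ge0.
  rewrite (@fubini_tonelli _ _ _ _ _ m1 m2
    (fun z : T1 * T2 => (`|F z| `^ r * k z.2)%:E))//=.
  (* The three factors come from Jensen's inequality, from the bound on the sections and from the
     integral of [k]. *)
  have -> : (C * M) `^ r = C `^ (r - 1) * (M `^ r * C).
    by rewrite powRM// -(mulr_powRB1 C0 r0); ring.
  rewrite EFinM lee_wpmul2l ?lee_fin ?powR_ge0//.
  rewrite EFinM -kC -ge0_integralZl//; last 3 first.
  - exact/measurable_EFinP.
  - by move=> y _; rewrite lee_fin.
  - by rewrite lee_fin powR_ge0.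
  apply: ge0_le_integral => //.
  - by move=> y _; apply: integral_ge0 => x _; exact: (H0 (x, y)).
  - exact: (measurable_fun_fubini_tonelli_G
      (fun z : T1 * T2 => (`|F z| `^ r * k z.2)%:E)).
  - by apply: emeasurable_funM => //; exact/measurable_EFinP.
  move=> y _ /=.
  under eq_integral do rewrite EFinM.
  rewrite ge0_integralZr//; last 2 first.
  - by apply/measurable_EFinP; exact: powm.
  - by rewrite lee_fin.
  have [->|ky] := eqVneq (k y) 0; first by rewrite !mule0.
  rewrite lee_wpmul2r ?lee_fin//.
  have := FM _ ky => /(ge0_le_poweR rnn (Lnorm_ge0 _ _ _)).
  by rewrite poweR_Lnorm.
(* By convention the sup norm is 0 on a space of measure 0. *)
- rewrite unlock; case: ifPn => [m0|_]; last by rewrite lee_fin mulr_ge0.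
  have {FM} FM y : k y != 0 -> {ae m1, forall x, `|F (x, y)| <= M}.
    move=> /FM; rewrite unlock m0 => /ess_supP; apply: filterS => x /=.
    by rewrite lee_fin.
  (* the part of [k] where [|F| > M] integrates to [0], by Tonelli *)
  pose h (z : T1 * T2) : \bar R := (if M < `|F z| then k z.2 else 0)%:E.
  have mh : measurable_fun setT h.
    apply/measurable_EFinP; apply: measurable_fun_ifT => //.
    by apply: measurable_fun_ltr => //; exact: measurableT_comp.
  have h0 z : (0 <= h z)%E by rewrite /h lee_fin; case: ifP.
  have : (\int[m1]_x \int[m2]_y h (x, y) = 0)%E.
    rewrite fubini_tonelli//; apply: integral0_eq => y _.
    have [ky|/FM ky] := eqVneq (k y) 0.
      by apply: integral0_eq => x _; rewrite /h/= ky if_same.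
    rewrite (@ae_eq_integral _ _ _ m1 _ (cst 0%E))// ?integral0//.
      by apply: (measurableT_comp mh); exact: measurable_pair2.
    by apply: filterS ky => x Mx _; rewrite /h/= ltNge Mx.
  have mI : measurable_fun setT (fun x => \int[m2]_y h (x, y))%E.
    exact: (measurable_fun_fubini_tonelli_F h).
  have -> : (\int[m1]_x \int[m2]_y h (x, y) = \int[m1]_x `| \int[m2]_y h (x, y) |)%E.
    apply: eq_integral => x _; rewrite gee0_abs//; exact: integral_ge0.
  move=> /(ae_eq_integral_abs m1 measurableT mI) H.
  apply/ess_supP; apply: filterS H => x /(_ I) /= Hx.
  apply: le_trans (GF x) _.
  have mhx : measurable_fun setT (fun y => h (x, y)).
    by apply: (measurableT_comp mh); exact: measurable_pair1.
  have : (\int[m2]_y `|h (x, y)| = 0)%E.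
    by rewrite -[RHS]Hx; apply: eq_integral => y _; rewrite gee0_abs.
  move=> /(ae_eq_integral_abs m2 measurableT mhx) {}Hx.
  rewrite mulrC EFinM -kC -ge0_integralZl//; last 2 first.
  - exact/measurable_EFinP.
  - by move=> y _; rewrite lee_fin.
  apply: ae_ge0_le_integral => //.
  - by move=> y _; rewrite lee_fin mulr_ge0.
  - apply/measurable_EFinP; apply: measurable_funM => //; exact: measurableT_comp.
  - by move=> y _; rewrite -EFinM lee_fin mulr_ge0.
  - by apply: emeasurable_funM => //; exact/measurable_EFinP.
  apply: filterS Hx => y /(_ I) + _; rewrite /h/= -EFinM lee_fin.
  by case: ltP => [_ [->]|? _]; rewrite ?mulr0// ler_wpM2r.
Qed.

End minkowski.

(** * Uniform continuity and derivatives *)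

Section epsilon_delta.
Context {R : realType} (n : nat).
Local Notation V := 'rV[R]_n.

Lemma continuous_rVP (f : V -> R) : continuous f <->
  forall x e, 0 < e -> exists2 d, 0 < d & forall y, `|y - x| < d -> `|f y - f x| < e.
Proof.
split=> [cf x e e0|H x].
  have /cvgrPdist_lt/(_ _ e0)/nbhs_normP[d /= d0 H] := cf x.
  exists d => // y yx; rewrite distrC; apply: (H y).
  by rewrite /= distrC.
apply/(@cvgrPdist_lt _ R^o _ (nbhs x) _ f (f x)) => e e0.
have [d d0 Hd] := H x e e0.
apply/nbhs_ballP; exists d => //= y; rewrite mx_norm_ball /ball_/= => yx.
by rewrite distrC; apply: Hd; rewrite distrC.
Qed.

(** States existence and value of the derivative together, so that a single estimate on difference
    quotients yields both. *)
Lemma derive_rVP (f : V -> R) (x v : V) (l : R) :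
  (derivable f x v /\ 'D_v f x = l) <->
  (forall e, 0 < e -> exists2 d, 0 < d & forall h, h != 0 -> `|h| < d ->
     `|h^-1 * (f (h *: v + x) - f x) - l| < e).
Proof.
split=> [[df <-] e e0|H].
  have : (fun h => h^-1 *: ((f \o shift x) (h *: v) - f x)) @ 0^' --> 'D_v f x by exact: df.
  move=> /cvgrPdist_lt/(_ _ e0); rewrite /dnbhs /within => /nbhs_normP[d /= d0 Hd].
  exists d => // h h0 hd; rewrite distrC; apply: (Hd h) => //.
  by rewrite /= sub0r normrN.
have C : (fun h => h^-1 *: ((f \o shift x) (h *: v) - f x)) @ 0^' --> l.
  apply/cvgrPdist_lt => e e0; have [d d0 Hd] := H e e0.
  apply/nbhs_normP; exists d => //= h; rewrite /= sub0r normrN => hd h0.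
  by rewrite distrC; exact: Hd.
split; first by apply/cvg_ex; exists l.
exact: cvg_lim.
Qed.

Lemma compact_norm_le (r : R) : compact [set x : V | `|x| <= r].
Proof.
apply: bounded_closed_compact.
  exists r; split; first exact: num_real.
  by move=> M rM x /= /le_trans; apply; exact: ltW.
rewrite (_ : [set x | _] = (fun x : V => `|x|) @^-1` `]-oo, r]%classic); last first.
  by apply/seteqP; split => x /=; rewrite in_itv.
by apply: closed_comp => [x _|]; [exact: norm_continuous|exact: interval_closed].
Qed.

(** Bounded support recorded by a sup-norm radius, which can be tracked explicitly through
    derivatives, reflections and dilations. *)
Definition vanishes_beyond (r : R) (g : V -> R) := forall x, r < `|x| -> g x = 0.

Lemma vanishes_beyond_unif_continuous (r : R) (g : V -> R) :
  continuous g -> vanishes_beyond r g ->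
  forall e, 0 < e ->
  exists2 d, 0 < d <= 1 & forall x y, `|x - y| < d -> `|g x - g y| < e.
Proof.
move=> cg gr e e0.
(* The margin 1 matches [d <= 1]: if [x] lies outside [K], then both [x] and [y] are beyond [r] and
   [g] is 0 at both. *)
pose K := [set x : V | `|x| <= r + 1].
have cK : compact K by exact: compact_norm_le.
have /compact_near_coveringP/(_ R (0 : R)^'+
  (fun d x => forall y, `|x - y| < d -> `|g x - g y| < e) _) := cK.
case.
  move=> x _; have e20 : 0 < e / 2 by rewrite divr_gt0.
  have [d d0 Hd] := (continuous_rVP g).1 cg x _ e20.
  have d20 : 0 < d / 2 by rewrite divr_gt0.
  exists (ball x (d / 2), [set t | t < d / 2]) => /=.
    by split; [exact: nbhsx_ballx|exact: nbhs_right_lt].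
  move=> [x' t] /= []; rewrite mx_norm_ball /ball_/= => xx'.
  move=> td y xy.
  have x'x : `|x' - x| < d by rewrite distrC; lra.
  have yx : `|y - x| < d.
    rewrite (_ : y - x = - ((x - x') + (x' - y))); last by rewrite subrKA opprB.
    by rewrite normrN (le_lt_trans (ler_normD _ _))//; lra.
  rewrite (_ : g x' - g y = (g x' - g x) - (g y - g x)); last by ring.
  rewrite (le_lt_trans (ler_normB _ _))//.
  by have := Hd _ x'x; have := Hd _ yx; lra.
move=> t /= t0 Ht.
pose d := Num.min (t / 2) 1.
have d0 : 0 < d by rewrite lt_min ltr01 divr_gt0.
have d1 : d <= 1 by rewrite ge_min lexx orbT.
have dt : d < t by rewrite gt_min; apply/orP; left; lra.
exists d; first by rewrite d0.
move=> x y xy; have [xr|xr] := leP `|x| (r + 1).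
  apply: (Ht d _ d0 x xr) => //=.
  by rewrite sub0r normrN gtr0_norm.
rewrite (gr x) ?(gr y) ?subrr ?normr0//.
  have := ler_normD (x - y) y; rewrite subrK; lra.
by lra.
Qed.

Lemma vanishes_beyond_bounded (r : R) (g : V -> R) :
  continuous g -> vanishes_beyond r g -> exists2 c, 0 <= c & forall x, `|g x| <= c.
Proof.
move=> cg gr.
(* The radius [|r|] keeps the ball nonempty for negative [r], as needed for a maximum. *)
have K0 : [set x : V | `|x| <= `|r|] !=set0 by exists 0; rewrite /= normr0.
have cng : {within [set x : V | `|x| <= `|r|], continuous (fun x => `|g x|)}.
  apply: continuous_subspaceT => x; apply: continuous_comp; first exact: cg.
  exact: norm_continuous.
have [c _ Hc] := compact_EVT_max K0 (@compact_norm_le _) cng.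
exists `|g c| => // x; have [xr|xr] := leP `|x| `|r|.
  by apply: Hc; rewrite inE.
by rewrite gr ?normr0// (le_lt_trans (ler_norm r)).
Qed.

Lemma vanishes_beyond_derive (r : R) (g : V -> R) (v : V) :
  vanishes_beyond r g -> vanishes_beyond r (fun x => 'D_v g x).
Proof.
move=> gr x xr; apply: (proj2 (proj2 (derive_rVP g x v 0) _)) => e e0.
have v1 : 0 < `|v| + 1 by rewrite ltr_wpDl.
(* Such increments satisfy [|h| * |v| < |x| - r], so the displaced point is still beyond [r]; the
   added 1 covers [v = 0]. *)
exists ((`|x| - r) / (`|v| + 1)); first by rewrite divr_gt0// subr_gt0.
move=> h _; rewrite ltr_pdivlMr// => hd.
rewrite (gr x xr) gr ?subrr ?mulr0 ?subr0 ?normr0//.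
have : `|x| <= `|h *: v + x| + `|h| * `|v|.
  by rewrite -normrZ -{1}(addKr (h *: v) x) addrC (le_trans (ler_normB _ _)).
have := normr_ge0 h; have := normr_ge0 v; rewrite mulrDr mulr1 in hd; lra.
Qed.

(** The one-dimensional mean value theorem on the line through [z] in direction [v], for increments
    of either sign. *)
Lemma rV_mean_value (g : V -> R) (v z : V) (h : R) :
  (forall x, derivable g x v) ->
  exists2 s, `|s| <= `|h| & g (h *: v + z) - g z = 'D_v g (s *: v + z) * h.
Proof.
move=> dg; pose f (s : R) : R := g (s *: v + z).
have df (s : R) : is_derive s 1 f ('D_v g (s *: v + z)).
  have E : (fun h : R => h^-1 *: ((f \o shift s) (h *: 1) - f s)) =
      (fun h : R => h^-1 *: ((g \o shift (s *: v + z)) (h *: v) - g (s *: v + z))).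
    by apply/funext => k; rewrite /f /= scalerDl [k *: 1]mulr1 addrA.
  split; first by rewrite /derivable E; exact: dg.
  by rewrite /derive E.
have cf (a b : R) : {within `[a, b], continuous f}.
  by apply: derivable_within_continuous => s _; exact: ex_derive.
have f0 : f 0 = g z by rewrite /f scale0r add0r.
have [h0|h0] := leP 0 h.
  have [s] := MVT_segment h0 (fun x _ => df x) (cf 0 h).
  rewrite in_itv/= => /andP[s0 sh]; rewrite f0 subr0 => E.
  by exists s => //; rewrite !ger0_norm.
have [s] := MVT_segment (ltW h0) (fun x _ => df x) (cf h 0).
rewrite in_itv/= => /andP[hs s0]; rewrite f0 sub0r => E.
exists s; first by rewrite !ler0_norm ?lerN2// ltW.
by rewrite -opprB E mulrN opprK.
Qed.

End epsilon_delta.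

(** * Smoothness of convolutions *)

Section convolution_smooth.
Context {R : realType} (n : nat).
Local Notation V := 'rV[R]_n.
Local Notation mu := (@borel_lebesgue R n).

Definition locally_integrable (f : V -> R) := measurable_fun setT f /\
  forall r, mu.-integrable [set x | `|x| <= r] (EFin \o f).

Definition mass (f : V -> R) (r : R) := \int[mu]_(x in [set x | `|x| <= r]) `|f x|.

Lemma mass_ge0 (f : V -> R) (r : R) : 0 <= mass f r.
Proof. by apply: Rintegral_ge0. Qed.

Lemma integrable_mul_vanishing (f h : V -> R) (r c : R) :
  locally_integrable f -> measurable_fun setT h -> vanishes_beyond r h ->
  (forall x, `|h x| <= c) ->
  mu.-integrable setT (EFin \o (fun x => f x * h x)).
Proof.
move=> [mf fi] mh hr hc.
have mB := @measurable_norm_le R n r.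
have -> : EFin \o (fun x => f x * h x) =
    (EFin \o (fun x => f x * h x)) \_ [set x : V | `|x| <= r].
  apply/funext => x; rewrite /patch; case: ifPn => // /negP; rewrite inE /= => xr.
  by rewrite hr ?mulr0// ltNge; apply/negP.
apply/(integrable_mkcond _ mB).
apply: (@le_integrable _ _ _ mu _ mB _ (fun x => c%:E * (EFin \o f) x)%E).
- by apply/measurable_EFinP; apply: measurable_funTS; exact: measurable_funM.
- move=> x _ /=; rewrite lee_fin !normrM mulrC ler_wpM2r//.
  by rewrite (le_trans (hc x))// ler_norm.
- by apply: integrableZl => //; exact: fi.
Qed.

Lemma normr_Rintegral_mul_vanishing (f h : V -> R) (r c : R) :
  locally_integrable f -> measurable_fun setT h -> vanishes_beyond r h ->
  (forall x, `|h x| <= c) ->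
  `|\int[mu]_x (f x * h x)| <= c * mass f r.
Proof.
move=> lf mh hr hc; have [mf fi] := lf.
have mB := @measurable_norm_le R n r.
have I := integrable_mul_vanishing lf mh hr hc.
apply: le_trans (le_normr_Rintegral measurableT I) _.
have -> : \int[mu]_x `|f x * h x| = \int[mu]_(x in [set x : V | `|x| <= r]) `|f x * h x|.
  rewrite [RHS]Rintegral_mkcond; apply: eq_Rintegral => x _.
  rewrite /patch; case: ifPn => // /negP; rewrite inE /= => xr.
  by rewrite hr ?mulr0 ?normr0// ltNge; apply/negP.
have fi' : mu.-integrable [set x : V | `|x| <= r] (EFin \o (fun x => `|f x|)).
  exact: (integrable_norm (fi r)).
rewrite -RintegralZl//; apply: le_Rintegral => //.
- apply: (integrableS measurableT) => //.
  exact: (integrable_norm I).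
- exact: (integrableZl mB c fi').
- by move=> x _; rewrite normrM mulrC ler_wpM2r.
Qed.

(** The variable [x] is placed in [g], so that limits and derivatives in [x] act on the smooth
    factor only; [convolE] gives the other form. *)
Definition convol (f g : V -> R) (x : V) := \int[mu]_y (f y * g (x - y)).

Lemma measurable_reflect (g : V -> R) (x : V) : measurable_fun setT g ->
  measurable_fun setT (fun y : V => g (x - y)).
Proof.
move=> mg; rewrite (_ : (fun y => _) = g \o (fun y => -1 *: y + x)).
  by apply: measurableT_comp => //; exact: measurable_rV_affine.
by apply/funext => y /=; rewrite scaleN1r addrC.
Qed.

Lemma vanishes_beyond_reflect (g : V -> R) (x : V) (r s : R) :
  vanishes_beyond r g -> `|x| + r <= s -> vanishes_beyond s (fun y => g (x - y)).
Proof.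
move=> gr xs y sy; apply: gr.
have : `|y| <= `|x| + `|x - y|.
  by rewrite -{1}(subKr x y) (le_trans (ler_normB _ _)).
lra.
Qed.

(** Uniform continuity of [g] makes [g (y - z) - g (x - z)] small for all [z] at once, and only the
    mass of [f] on a fixed ball enters. *)
Lemma continuous_convol (f g : V -> R) (r : R) : locally_integrable f ->
  continuous g -> vanishes_beyond r g -> continuous (convol f g).
Proof.
move=> lf cg gr; apply/continuous_rVP => x e e0.
have mg := continuous_measurable_rV cg.
have [K K0 gK] := vanishes_beyond_bounded cg gr.
(* For [y] within distance 1 of [x], both reflected copies of [g] vanish beyond [s]. Adding 1 to the
   mass below makes the quotient meaningful and the final inequality strict. *)
pose s := `|x| + 1 + r.
have A0 : 0 < mass f s + 1 by rewrite ltr_wpDl// mass_ge0.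
have eA : 0 < e / (mass f s + 1) by rewrite divr_gt0.
have [d /andP[d0 d1] Hd] := vanishes_beyond_unif_continuous cg gr eA.
exists d => // y yx.
have ys : `|y| + r <= s.
  have : `|y| <= `|y - x| + `|x| by rewrite -{1}(subrK x y) ler_normD.
  by rewrite /s; lra.
have xs : `|x| + r <= s by rewrite /s; lra.
have I z : `|z| + r <= s -> mu.-integrable setT (EFin \o (fun y => f y * g (z - y))).
  move=> zs; apply: (@integrable_mul_vanishing _ (fun y => g (z - y)) s K) => //.
    exact: measurable_reflect.
  exact: vanishes_beyond_reflect zs.
rewrite /convol -RintegralB//; [|exact: I..].
under eq_Rintegral do rewrite -mulrBr.
apply: (@le_lt_trans _ _ (e / (mass f s + 1) * mass f s)).
  apply: (@normr_Rintegral_mul_vanishing f (fun z => g (y - z) - g (x - z))) => //.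
  - by apply: measurable_funB; exact: measurable_reflect.
  - move=> z sz; rewrite (vanishes_beyond_reflect gr ys)//.
    by rewrite (vanishes_beyond_reflect gr xs)// subrr.
  - move=> z; apply/ltW/Hd; rewrite opprB addrA subrK//.
by rewrite mulrAC ltr_pdivrMr// ltr_pM2l//; lra.
Qed.

(** By the mean value theorem the difference quotient of [g] is a value of ['D_v g] at a nearby
    point, hence uniformly close to ['D_v g (x - z)]; integration against [f] preserves the
    smallness. *)
Lemma derive_convol (f g : V -> R) (v : V) (r : R) : locally_integrable f ->
  continuous g -> vanishes_beyond r g -> (forall x, derivable g x v) ->
  continuous (fun x => 'D_v g x) ->
  forall x, derivable (convol f g) x v /\
    'D_v (convol f g) x = convol f (fun x => 'D_v g x) x.
Proof.
move=> lf cg gr dg cDg x; apply/derive_rVP => e e0.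
have mg := continuous_measurable_rV cg.
have mDg := continuous_measurable_rV cDg.
have Dgr := @vanishes_beyond_derive _ _ _ _ v gr.
have [K K0 gK] := vanishes_beyond_bounded cg gr.
have [K' K'0 DgK] := vanishes_beyond_bounded cDg Dgr.
pose s := `|x| + 1 + r.
have A0 : 0 < mass f s + 1 by rewrite ltr_wpDl// mass_ge0.
have eA : 0 < e / (mass f s + 1) by rewrite divr_gt0.
have [d /andP[d0 d1] Hd] := vanishes_beyond_unif_continuous cDg Dgr eA.
have v0 : 0 < `|v| + 1 by rewrite ltr_wpDl.
exists (d / (`|v| + 1)); first by rewrite divr_gt0.
move=> h h0; rewrite ltr_pdivlMr// mulrDr mulr1 => hd.
have hv : `|h| * `|v| < d by have := normr_ge0 h; lra.
pose y := h *: v + x.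
have ys : `|y| + r <= s.
  have : `|y| <= `|h| * `|v| + `|x| by rewrite -normrZ ler_normD.
  by rewrite /s; lra.
have xs : `|x| + r <= s by rewrite /s; lra.
have I z : `|z| + r <= s -> mu.-integrable setT (EFin \o (fun y => f y * g (z - y))).
  move=> zs; apply: (@integrable_mul_vanishing _ (fun y => g (z - y)) s K) => //.
    exact: measurable_reflect.
  exact: vanishes_beyond_reflect zs.
have J : mu.-integrable setT (EFin \o (fun y => f y * 'D_v g (x - y))).
  apply: (@integrable_mul_vanishing _ (fun y => 'D_v g (x - y)) s K') => //.
    exact: (measurable_reflect x mDg).
  exact: (vanishes_beyond_reflect Dgr xs).
have mdiff : measurable_fun setT (fun z : V => g (y - z) - g (x - z)).
  by apply: measurable_funB; exact: measurable_reflect.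
have I2 : mu.-integrable setT (EFin \o (fun z => f z * (g (y - z) - g (x - z)))).
  apply: (@integrable_mul_vanishing _ (fun z => g (y - z) - g (x - z)) s (K + K)) => //.
  - move=> z sz; rewrite (vanishes_beyond_reflect gr ys)//.
    by rewrite (vanishes_beyond_reflect gr xs)// subrr.
  - by move=> z; rewrite (le_trans (ler_normB _ _))// lerD.
have I3 : mu.-integrable setT (EFin \o (fun z => h^-1 * (f z * (g (y - z) - g (x - z))))).
  exact: (integrableZl measurableT h^-1 I2).
have -> : h^-1 * (convol f g y - convol f g x) - convol f (fun x => 'D_v g x) x =
    \int[mu]_z (f z * (h^-1 * (g (y - z) - g (x - z)) - 'D_v g (x - z))).
  rewrite /convol -RintegralB//; [|exact: I..].
  under eq_Rintegral do rewrite -mulrBr.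
  rewrite -RintegralZl// -RintegralB//.
  by apply: eq_Rintegral => z _; ring.
apply: (@le_lt_trans _ _ (e / (mass f s + 1) * mass f s)).
  apply: (@normr_Rintegral_mul_vanishing f
    (fun z => h^-1 * (g (y - z) - g (x - z)) - 'D_v g (x - z))) => //.
  - exact: (measurable_funB (measurable_funM (measurable_cst h^-1) mdiff)
      (measurable_reflect x mDg)).
  - move=> z sz; rewrite (vanishes_beyond_reflect gr ys)//.
    rewrite (vanishes_beyond_reflect gr xs)//.
    by rewrite (vanishes_beyond_reflect Dgr xs)// subrr mulr0 subrr.
  - move=> z; rewrite /y -addrA; have [t th ->] := rV_mean_value (x - z) h dg.
    rewrite mulrC mulfK//; apply/ltW/Hd; rewrite addrK normrZ.
    by rewrite (le_lt_trans _ hv)// ler_wpM2r.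
by rewrite mulrAC ltr_pdivrMr// ltr_pM2l//; lra.
Qed.

Lemma Ck_continuous k (g : V -> R) : Ck k g -> continuous g.
Proof. by case: k => [|k] []. Qed.

Lemma Ck_convol k (f g : V -> R) (r : R) : locally_integrable f ->
  Ck k g -> vanishes_beyond r g -> Ck k (convol f g).
Proof.
move=> lf; elim: k g => [|k IH] g [cg dg] gr.
  by split => //; exact: continuous_convol gr.
split; first exact: continuous_convol gr.
move=> i; have [di Ci] := dg i.
have H := derive_convol lf cg gr di (Ck_continuous Ci).
split; first by move=> x; have [] := H x.
have -> : (fun x => 'D_(delta_mx ord0 i) (convol f g) x) =
    convol f (fun x => 'D_(delta_mx ord0 i) g x).
  by apply/funext => x; have [] := H x.
by apply: IH => //; exact: vanishes_beyond_derive.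
Qed.

Lemma continuous_dilate (c a : R) (g : V -> R) :
  continuous g -> continuous (fun x : V => c * g (a *: x)).
Proof.
move=> cg x; apply: (@continuous_comp _ _ _ (fun x : V => g (a *: x)) ( *%R c)).
  apply: (@continuous_comp V V R (fun y : V => a *: y) g x); last exact: cg.
  exact: scaler_continuous.
exact: mulrl_continuous.
Qed.

(** The factor [c] is arbitrary because each derivative multiplies it by [a], and the induction has
    to absorb this. *)
Lemma Ck_dilate k (c a : R) (g : V -> R) :
  Ck k g -> Ck k (fun x : V => c * g (a *: x)).
Proof.
elim: k c g => [|k IH] c g Cg; have cg := Ck_continuous Cg.
  by split => //; exact: continuous_dilate.
split; first exact: continuous_dilate.
move=> i; have [di Ci] := Cg.2 i.
set v := delta_mx ord0 i.
have H x : derivable (fun x : V => c * g (a *: x)) x v /\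
    'D_v (fun x : V => c * g (a *: x)) x = c * a * 'D_v g (a *: x).
  apply/derive_rVP => e e0.
  have ca0 : 0 < `|c * a| + 1 by rewrite ltr_wpDl.
  have eca : 0 < e / (`|c * a| + 1) by rewrite divr_gt0.
  have [d d0 Hd] := (derive_rVP g (a *: x) v _).1 (conj (di _) erefl) _ eca.
  have a1 : 0 < `|a| + 1 by rewrite ltr_wpDl.
  exists (d / (`|a| + 1)); first by rewrite divr_gt0.
  move=> h h0; rewrite ltr_pdivlMr// mulrDr mulr1 => hd.
  (* For [a = 0] the function is constant; otherwise the increment [h * a] is nonzero and the
     estimate for [g] applies to it. *)
  have [->|a0] := eqVneq a 0.
    by rewrite !scale0r subrr !mulr0 mul0r subrr normr0.
  have ha : `|h * a| < d by rewrite normrM; have := normr_ge0 h; lra.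
  have := Hd (h * a) (mulf_neq0 h0 a0) ha.
  rewrite scalerDr scalerA (mulrC a h); set D := 'D_v g _; set G1 := g _; set G0 := g _.
  move=> HD; have -> : h^-1 * (c * G1 - c * G0) - c * a * D =
      (c * a) * ((h * a)^-1 * (G1 - G0) - D) by field; rewrite h0 a0.
  rewrite normrM; apply: (@le_lt_trans _ _ (`|c * a| * (e / (`|c * a| + 1)))).
    by rewrite ler_wpM2l// ltW.
  by rewrite mulrA ltr_pdivrMr// mulrC ltr_pM2l//; lra.
split; first by move=> x; have [] := H x.
have -> : (fun x => 'D_v (fun x : V => c * g (a *: x)) x) =
    (fun x => c * a * 'D_v g (a *: x)) by apply/funext => x; have [] := H x.
exact: (IH (c * a) (fun x => 'D_v g x) Ci).
Qed.


End convolution_smooth.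

(** * Lp norms and local integrability *)

Section ereal_limit.
Context {R : realType}.

Lemma cvge0P (T : Type) (F : set_system T) (FF : Filter F) (u : T -> \bar R) :
  (forall t, 0 <= u t)%E ->
  u t @[t --> F] --> 0%E <->
  forall e : R, 0 < e -> \forall t \near F, (u t <= e%:E)%E.
Proof.
move=> u0; split=> [cu e e0|H A].
  apply: (cu [set y | (y <= e%:E)%E]).
  change (\forall r \near (0 : R), (r%:E <= e%:E)%E).
  apply/nbhs_ballP; exists e => //= r; rewrite /ball/= sub0r normrN lee_fin => re.
  by rewrite (le_trans (ler_norm r))// ltW.
rewrite -[nbhs _ _]/(\forall r \near (0 : R), A r%:E).
move=> /nbhs_ballP[d /= d0 dA]; apply: filterS (H (d / 2) _); last by rewrite divr_gt0.
move=> t ut; have ufin : u t \is a fin_num.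
  by rewrite ge0_fin_numE// (le_lt_trans ut)// ltry.
have := u0 t; rewrite -(fineK ufin) in ut *; rewrite !lee_fin in ut * => t0.
rewrite /= -(fineK ufin); apply: dA; rewrite /ball/= sub0r normrN ger0_norm//; lra.
Qed.

End ereal_limit.

(** * Translation of L^p norms, and local integrability from L^p bounds on balls *)

Section Lnorm_borel.
Context {R : realType} (n : nat).
Local Notation V := 'rV[R]_n.
Local Notation mu := (@borel_lebesgue R n).

Lemma Lnorm_translate (p : \bar R) (h : V -> R) (y : V) (M : R) :
  (1 <= p)%E -> measurable_fun setT h ->
  (Lnorm mu p (EFin \o h) <= M%:E)%E ->
  (Lnorm mu p (EFin \o translate y h) <= M%:E)%E.
Proof.
move=> p1 mh; rewrite unlock; case: p p1 => [r r1||//] /=.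
- rewrite [in X in X -> _](@integral_affine R n 1 (- y))//; last first.
    apply: (@measurableT_comp _ _ _ _ _ _ (fun u : R => (`|u| `^ r)%:E)) => //.
    apply/measurable_EFinP.
    apply: (@measurableT_comp _ _ _ _ _ _ (@powR R ^~ r) _ (@Num.norm R R)).
      exact: measurable_powR.
    exact: normr_measurable.
  rewrite normr1 expr1n mul1e; under eq_integral do rewrite scale1r; exact.
- move=> _; case: ifPn => // m0 /ess_supP H; apply/ess_supP.
  move: H => [N [mN N0 HN]].
  exists ((fun v => 1 *: v - y) @^-1` N); split.
  + by rewrite -[X in measurable X]setTI; exact: measurable_rV_affine.
  + by have := borel_lebesgue_affine (- y) (oner_neq0 R) mN;
      rewrite normr1 expr1n mul1e N0.
  + move=> x /= Hx; apply: HN => /=; rewrite scale1r; exact: Hx.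
Qed.

(** On a set [B] of finite measure L^p is contained in L^1: for finite [r] the function is dominated
    by [1_B + |g| ^ r], for infinite exponent by a multiple of [1_B]. *)
Lemma Lnorm_lty_integrable (p : \bar R) (B : set V) (h : V -> R) :
  (1 <= p)%E -> measurable B -> (mu B < +oo)%E -> measurable_fun setT h ->
  (Lnorm mu p (EFin \o (h \_ B)) < +oo)%E ->
  mu.-integrable setT (EFin \o (h \_ B)).
Proof.
move=> p1 mB Boo mh.
have mg : measurable_fun setT (h \_ B).
  by apply/(measurable_restrictT _ mB); exact: measurable_funTS.
have gB x : ~ B x -> (h \_ B) x = 0 by move=> Bx; rewrite /patch memNset.
move: (h \_ B) mg gB => g mg gB Loo.
have iB : mu.-integrable setT (fun x => (\1_B x)%:E).
  apply/integrableP; split; first exact/measurable_EFinP.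
  under eq_integral do rewrite gee0_abs ?lee_fin//.
  by rewrite integral_indic// setIT.
case: p p1 Loo => [r r1||//].
- rewrite lee_fin in r1; have r0 : 0 < r by rewrite (lt_le_trans _ r1).
  have rN0 : r != 0 by rewrite gt_eqF.
  move=> Loo.
  have mpow : measurable_fun setT (fun x => `|g x| `^ r).
    apply: (@measurableT_comp _ _ _ _ _ _ (@powR R ^~ r)).
      exact: measurable_powR.
    exact: measurableT_comp.
  have ip : mu.-integrable setT (fun x => (`|g x| `^ r)%:E).
    apply/integrableP; split; first exact/measurable_EFinP.
    under eq_integral do rewrite gee0_abs ?lee_fin ?powR_ge0//.
    by have := poweR_lty r Loo; rewrite poweR_Lnorm.
  apply: (@le_integrable _ _ _ mu _ measurableT _
    (fun x => (\1_B x)%:E + (`|g x| `^ r)%:E)%E) => //.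
  + exact/measurable_EFinP.
  + move=> x _ /=; rewrite lee_fin [leRHS]ger0_norm ?addr_ge0 ?powR_ge0//.
    have [Bx|Bx] := pselect (B x); last by rewrite (gB x Bx) normr0 addr_ge0// powR_ge0.
    rewrite indicE mem_set//=; have [g1|g1] := leP `|g x| 1.
      by rewrite ler_wpDr// powR_ge0.
    by rewrite ler_wpDl// le1r_powR// ltW.
  + exact: integrableD.
- move=> _; rewrite unlock; case: ifPn => [m0|m0 _]; last first.
    have mT0 : mu setT = 0%E.
      by apply/eqP; rewrite eq_le measure_ge0 andbT leNgt.
    apply/integrableP; split; first exact/measurable_EFinP.
    rewrite (@ae_eq_integral _ _ _ mu _ (cst 0%E))// ?integral0//.
      by apply: measurableT_comp => //; exact/measurable_EFinP.
    exact: (@ae_eq0 _ _ _ _ setT _ _ _ measurableT mT0).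
  move=> Loo.
  have L0 : (0 <= ess_sup mu (abse \o (EFin \o g)))%E.
    by apply: ess_sup_gee => //; apply/nearW => x /=; rewrite lee_fin.
  have [M ME] : exists M, ess_sup mu (abse \o (EFin \o g)) = M%:E.
    by exists (fine (ess_sup mu (abse \o (EFin \o g)))); rewrite fineK// ge0_fin_numE.
  rewrite ME lee_fin in L0.
  have /ess_supP H : (ess_sup mu (abse \o (EFin \o g)) <= M%:E)%E by rewrite ME.
  apply/integrableP; split; first exact/measurable_EFinP.
  apply: (@le_lt_trans _ _ (\int[mu]_x (M%:E * (\1_B x)%:E))%E).
    apply: ae_ge0_le_integral => //.
    + by apply: measurableT_comp => //; exact/measurable_EFinP.
    + by move=> x _; rewrite mule_ge0// lee_fin.
    + by apply: emeasurable_funM => //; exact/measurable_EFinP.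
    + apply: filterS H => x /= Hx _.
      have [Bx|Bx] := pselect (B x); last by rewrite (gB x Bx) normr0 mule_ge0// lee_fin.
      by rewrite indicE mem_set//= mule1.
  rewrite ge0_integralZl//.
  + by rewrite integral_indic// setIT lte_mul_pinfty// lee_fin.
  + exact/measurable_EFinP.
Qed.

Lemma eball_lty (x : V) (r : R) : (mu (eball x r) < +oo)%E.
Proof.
apply: le_lt_trans (borel_lebesgue_norm_le n (`|x| + r)).
apply: le_measure; rewrite ?inE.
- exact: measurable_eball.
- exact: measurable_norm_le.
- move=> y /= /(le_lt_trans (norm_le_enorm _)) xy.
  by rewrite -{1}(subKr x y) (le_trans (ler_normB _ _))// lerD2l ltW.
Qed.

(** By compactness a sup-norm ball of any radius [s] is covered by finitely many Euclidean balls of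
    the one radius [r], and [h] is integrable on each. *)
Lemma Lnorm_lty_locally_integrable (p : \bar R) (h : V -> R) (r : R) :
  (1 <= p)%E -> measurable_fun setT h -> 0 < r ->
  (forall x, Lnorm mu p (EFin \o (h \_ (eball x r))) < +oo)%E ->
  locally_integrable h.
Proof.
move=> p1 mh r0 H; split => // s.
have I x : mu.-integrable setT (EFin \o (h \_ (eball x r))).
  by apply: Lnorm_lty_integrable (H x) => //; [exact: measurable_eball|exact: eball_lty].
(* A sup-norm ball of radius [d] fits into the Euclidean ball of radius [r] with the same centre,
   since the Euclidean norm is at most [sqrt n] times the sup norm. *)
pose d := r / (Num.sqrt n%:R + 1).
have s0 : 0 < Num.sqrt n%:R + 1 :> R by rewrite ltr_wpDl// sqrtr_ge0.
have d0 : 0 < d by rewrite divr_gt0.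
have arith (u : R) : 0 <= u -> u < d -> Num.sqrt n%:R * u < r.
  by move=> u0; rewrite ltr_pdivlMr// mulrDr mulr1 mulrC; lra.
have dB (x : V) : ball x d `<=` eball x r.
  move=> y; rewrite mx_norm_ball /ball_/= /eball/= => xy.
  apply: le_lt_trans (enorm_le_norm (x - y)) _.
  exact: arith.
have := @compact_norm_le R n s; rewrite compact_cover.
move=> /(_ V setT (fun x => ball x d)) [].
- by move=> x _; exact: ball_open.
- by move=> x _; exists x => //; exact: ballxx.
move=> D _ sD.
have mB := @measurable_norm_le R n s.
pose k (x : V) := (\sum_(c <- finmap.enum_fset D) `|((h \_ (eball c r)) x)%:E|)%E.
apply: (@le_integrable _ _ _ mu _ mB (EFin \o h) k).
- by apply/measurable_EFinP; exact: measurable_funTS.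
- move=> x /sD[c /= cD /dB xc].
  rewrite [leRHS]gee0_abs; last by apply: sume_ge0 => c' _; exact: abse_ge0.
  rewrite /k (big_rem c)//=; apply: (@le_trans _ _ (`|((h \_ (eball c r)) x)%:E|)%E).
    by rewrite /patch mem_set.
  by rewrite leeDl// sume_ge0// => c' _; exact: abse_ge0.
- apply: (integrableS measurableT) => //; apply: integrable_sum => // c _.
  exact: (integrable_abse (I c)).
Qed.

End Lnorm_borel.

(** * Morrey norms *)

Section convolution_borel.
Context {R : realType} (n : nat).
Local Notation V := 'rV[R]_n.
Local Notation mu := (@borel_lebesgue R n).
Implicit Types (f g h : V -> R).

Lemma convolE f g x : measurable_fun setT f -> measurable_fun setT g ->
  convol f g x = \int[mu]_y (f (x - y) * g y).
Proof.
move=> mf mg; rewrite /convol /Rintegral; congr fine.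
rewrite (@integral_affine R n (-1) x) ?oppr_eq0 ?oner_neq0//; last first.
  by apply/measurable_EFinP; apply: measurable_funM => //; exact: measurable_reflect.
rewrite normrN1 expr1n mul1e; apply: eq_integral => y _ /=.
by rewrite scaleN1r (addrC (- y)) subKr.
Qed.

Lemma measurable_translate f (y : V) :
  measurable_fun setT f -> measurable_fun setT (translate y f).
Proof.
move=> mf; rewrite (_ : translate y f = f \o (fun x => 1 *: x - y)).
  by apply: measurableT_comp => //; exact: measurable_rV_affine.
by apply/funext => z /=; rewrite scale1r.
Qed.

Lemma ae_borel_translate f f' (y : V) : ae_borel f f' ->
  ae_borel (translate y f) (translate y f').
Proof.
move=> /(ae_borel_affine (- y) (oner_neq0 R)) [N [mN N0 ff']].
by exists N; split => // x /ff'; rewrite /translate scale1r.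
Qed.

(** For each fixed [x] the exceptional set in [y] is an affine preimage of a Borel null set, hence
    null; so the equality holds at every point. *)
Lemma convolution_convol f f' g : measurable_fun setT f' -> ae_borel f f' ->
  measurable_fun setT g -> convolution f g = convol f' g.
Proof.
move=> mf' ff' mg; apply/funext => x; rewrite convolE//.
apply: ae_borel_Rintegral.
  by apply: measurable_funM => //; exact: measurable_reflect.
apply: (ae_borel_op (fun a b : R => a * b)); last exact: ae_borel_refl.
have m1 : (-1 : R) != 0 by rewrite oppr_eq0 oner_neq0.
have [N [mN N0 H]] := ae_borel_affine x m1 ff'.
by exists N; split => // y /H; rewrite scaleN1r addrC.
Qed.

Lemma normr_Rintegral_le d (T : measurableType d) (nu : {measure set T -> \bar R})
    (h : T -> R) : measurable_fun setT h ->
  (`|\int[nu]_y h y|%:E <= \int[nu]_y `|h y|%:E)%E.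
Proof.
move=> mh; have mh' : measurable_fun setT (EFin \o h) by exact/measurable_EFinP.
apply: le_trans (le_abse_integral nu measurableT mh').
(* An infinite integral is sent to 0 by [fine], and the inequality is then trivial. *)
by rewrite /Rintegral; case: (\int[nu]_y _)%E => //=; rewrite normr0 leey.
Qed.

End convolution_borel.

(** * Morrey norms of Borel functions, their translates and their averages *)

Section morrey_borel.
Context {R : realType} (n : nat).
Local Notation V := 'rV[R]_n.
Local Notation mu := (@borel_lebesgue R n).
Variables (p : \bar R) (w : R -> R).
Hypotheses (p1 : (1 <= p)%E) (w_ge0 : forall r, 0 < r -> 0 <= w r).
Implicit Types (f g h : V -> R).

Lemma Lp_norm_restrict (B : set V) h : measurable B -> measurable_fun setT h ->
  Lp_norm p B h = Lnorm mu p (EFin \o (h \_ B)).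
Proof. by move=> mB mh; apply: Lp_norm_borel => //; exact: ae_borel_refl. Qed.

Lemma morrey_norm_ae f f' : measurable_fun setT f' -> ae_borel f f' ->
  morrey_norm p w f = morrey_norm p w f'.
Proof.
move=> mf' ff'; rewrite /morrey_norm; congr ereal_sup.
apply: eq_imagel => -[x r] _ /=; congr (_ * _)%E.
rewrite (Lp_norm_borel p1 _ mf' ff'); last exact: measurable_eball.
by rewrite Lp_norm_restrict//; exact: measurable_eball.
Qed.

Lemma morrey_norm_ge0 f : (0 <= morrey_norm p w f)%E.
Proof.
apply: (@le_trans _ _ ((w 1)%:E * Lp_norm p (eball 0 1) f)%E).
  by rewrite mule_ge0// ?lee_fin ?w_ge0// Lnorm_ge0.
by apply: ereal_sup_ubound; exists (0, 1) => //=.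
Qed.

(** Radii with [w r = 0] contribute 0 to the supremum, so only radii where one may divide by [w r]
    have to be tested. *)
Lemma morrey_norm_le f (D : R) : 0 <= D ->
  (forall x r, 0 < r -> 0 < w r -> (Lp_norm p (eball x r) f <= (D / w r)%:E)%E) ->
  (morrey_norm p w f <= D%:E)%E.
Proof.
move=> D0 H; apply: ge_ereal_sup => _ [[x r] /= r0 <-].
have /predU1P[<-|wr] : (0 == w r) || (0 < w r); first by rewrite -le_eqVlt w_ge0.
  by rewrite mul0e lee_fin.
by rewrite muleC -lee_pdivlMr// -EFinM; exact: H.
Qed.

Lemma Lp_norm_le_morrey f (D : R) x r : (morrey_norm p w f <= D%:E)%E ->
  0 < r -> 0 < w r -> (Lp_norm p (eball x r) f <= (D / w r)%:E)%E.
Proof.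
move=> H r0 wr; rewrite EFinM lee_pdivlMr// muleC.
by apply: le_trans H; apply: ereal_sup_ubound; exists (x, r).
Qed.

(** Translation moves the ball to another centre with the same radius, hence the same weight, and
    the supremum runs over all centres. *)
Lemma morrey_norm_translate f (y : V) (D : R) : 0 <= D -> measurable_fun setT f ->
  (morrey_norm p w f <= D%:E)%E -> (morrey_norm p w (translate y f) <= D%:E)%E.
Proof.
move=> D0 mf H; apply: morrey_norm_le => // x r r0 wr.
have mt := measurable_translate y mf.
rewrite Lp_norm_restrict//; last exact: measurable_eball.
have -> : (translate y f) \_ (eball x r) = translate y (f \_ (eball (x - y) r)).
  apply/funext => z; rewrite /translate /patch.
  have -> : (z - y \in eball (x - y) r) = (z \in eball x r).
    by apply/idP/idP => /set_mem zB; apply/mem_set; move: zB;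
      rewrite /eball/= opprB addrA subrK.
  by [].
apply: Lnorm_translate => //.
  apply/(measurable_restrictT _ (measurable_eball _ _)).
  exact: measurable_funTS.
rewrite -Lp_norm_restrict//; last exact: measurable_eball.
exact: Lp_norm_le_morrey.
Qed.

(** Minkowski's inequality ball by ball. It serves twice: with [f' (x - y)] for the bound on the
    convolution and with [f' (x - y) - f' x] for the convergence. *)
Lemma morrey_norm_average (H : V * V -> R) (k G : V -> R) (C D : R) :
  measurable_fun setT H -> measurable_fun setT k -> (forall y, 0 <= k y) ->
  measurable_fun setT G -> (\int[mu]_y (k y)%:E = C%:E)%E -> 0 <= D ->
  (forall y, k y != 0 -> (morrey_norm p w (fun x => H (x, y)) <= D%:E)%E) ->
  (forall x, (`|G x|%:E <= \int[mu]_y (`|H (x, y)| * k y)%:E)%E) ->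
  (morrey_norm p w G <= (C * D)%:E)%E.
Proof.
move=> mH mk k0 mG kC D0 HD GH.
have C0 : 0 <= C by rewrite -lee_fin -kC; apply: integral_ge0 => y _; rewrite lee_fin.
apply: morrey_norm_le => [|x0 r r0 wr]; first by rewrite mulr_ge0.
have mB : measurable (eball x0 r) by exact: measurable_eball.
rewrite Lp_norm_restrict// -mulrA.
(* The restriction to the ball is written as a product with an indicator to obtain joint
   measurability. *)
pose F (z : V * V) := (\1_(eball x0 r) z.1 : R) * H z.
have FE y : (fun x => F (x, y)) = (fun x => H (x, y)) \_ (eball x0 r).
  apply/funext => x; rewrite /F/= /patch indicE.
  by case: ifPn => // _; rewrite ?mul1r ?mul0r.
apply: (@Lnorm_integral_le R _ _ V V mu mu p F k _ C (D / w r)) => //.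
- apply: measurable_funM => //.
  exact: (measurableT_comp (measurable_indic mB) measurable_fst).
- by apply/(measurable_restrictT _ mB); exact: measurable_funTS.
- by rewrite divr_ge0// ltW.
- move=> y ky; rewrite -[X in Lnorm _ _ X]/(EFin \o (fun x => F (x, y))) FE -Lp_norm_restrict//.
    by apply: Lp_norm_le_morrey => //; exact: HD.
  by apply: (measurableT_comp mH); exact: measurable_pair2.
- move=> x; rewrite /F /= /patch indicE; case: ifPn => _.
    by under eq_integral do rewrite mul1r; exact: GH.
  by rewrite normr0; apply: integral_ge0 => y _; rewrite lee_fin mulr_ge0.
Qed.

End morrey_borel.

(** * Approximate identities *)

Section approximate_identity.
Context {R : realType} (n : nat).
Local Notation V := 'rV[R]_n.
Local Notation mu := (@borel_lebesgue R n).
Implicit Types (f g h : V -> R).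

Lemma integrable_vanishing g (r : R) : continuous g -> vanishes_beyond r g ->
  mu.-integrable setT (EFin \o g).
Proof.
move=> cg gr; have [c c0 gc] := vanishes_beyond_bounded cg gr.
have -> : EFin \o g = EFin \o (fun x => cst 1 x * g x).
  by apply/funext => x /=; rewrite mul1r.
apply: (@integrable_mul_vanishing R n (cst 1) g r c) => //; last first.
  exact: continuous_measurable_rV.
split => // s; have mB := @measurable_norm_le R n s.
apply/integrableP; split; first exact/measurable_EFinP.
under eq_integral do rewrite /= normr1.
by rewrite integral_cst// mul1e borel_lebesgue_norm_le.
Qed.

Lemma integral_dilate g (t r : R) : 0 < t ->
  continuous g -> vanishes_beyond r g ->
  (\int[mu]_x (dilate t g x)%:E = \int[mu]_x (g x)%:E)%E.
Proof.
move=> t0 cg gr; have tN0 : t != 0 by rewrite gt_eqF.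
have mg := continuous_measurable_rV cg.
have md : measurable_fun setT (dilate t g).
  by apply: continuous_measurable_rV; exact: continuous_dilate.
rewrite (@integral_affine R n t 0)//; last exact/measurable_EFinP.
have E x : dilate t g (t *: x + 0) = t ^- n * g x.
  by rewrite /dilate addr0 scalerA mulVf// scale1r.
under eq_integral do rewrite E EFinM.
rewrite integralZl//; last exact: integrable_vanishing gr.
by rewrite gtr0_norm// muleA -EFinM divff ?mul1e// expf_neq0.
Qed.

Lemma vanishes_beyond_dilate g (t r : R) : 0 < t -> vanishes_beyond r g ->
  vanishes_beyond (t * r) (dilate t g).
Proof.
move=> t0 gr x tx; rewrite /dilate gr ?mulr0// normrZ gtr0_norm ?invr_gt0//.
by rewrite mulrC ltr_pdivlMr// mulrC.
Qed.

(** Makes [(x, y) |-> f (x - y)] measurable on the product for Borel [f], as Tonelli requires. *)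
Lemma measurable_sub_rV : measurable_fun setT (fun z : V * V => z.1 - z.2).
Proof.
apply: measurable_fun_rVP => i.
rewrite (_ : (fun z : V * V => _) =
    (fun z => (z.1 ord0 i : measurableTypeR R) - z.2 ord0 i)); last first.
  by apply/funext => z; rewrite !mxE.
by apply: measurable_funB;
  [apply: (measurableT_comp (measurable_rV_coord i)); exact: measurable_fst
  |apply: (measurableT_comp (measurable_rV_coord i)); exact: measurable_snd].
Qed.

Lemma convol_le f g x : measurable_fun setT f -> measurable_fun setT g ->
  (`|convol f g x|%:E <= \int[mu]_y (`|f (x - y)| * `|g y|)%:E)%E.
Proof.
move=> mf mg; rewrite convolE//.
under eq_integral do rewrite -normrM.
apply: normr_Rintegral_le; apply: measurable_funM => //.
exact: measurable_reflect.
Qed.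

(** As [g] has integral 1, [f x] is the integral of [f x * g (x - y)], so the difference is a single
    integral; reflecting [y] gives the stated form. *)
Lemma convol_sub_le f g x (r : R) : locally_integrable f -> continuous g ->
  vanishes_beyond r g -> (\int[mu]_y (g y)%:E = 1)%E ->
  (`|convol f g x - f x|%:E <= \int[mu]_y (`|f (x - y) - f x| * `|g y|)%:E)%E.
Proof.
move=> lf cg gr g1; have mg := continuous_measurable_rV cg; have [mf _] := lf.
have mgx := measurable_reflect x mg.
have [c c0 gc] := vanishes_beyond_bounded cg gr.
have m1 : (-1 : R) != 0 by rewrite oppr_eq0 oner_neq0.
have I1 : mu.-integrable setT (EFin \o (fun y => f y * g (x - y))).
  apply: (@integrable_mul_vanishing R n f (fun y => g (x - y)) (`|x| + r) c) => //.
  exact: (vanishes_beyond_reflect gr).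
have I2 : mu.-integrable setT (EFin \o (fun y => g (x - y))).
  apply: (@integrable_vanishing _ (`|x| + r)); last exact: (vanishes_beyond_reflect gr).
  rewrite (_ : (fun y => _) = g \o (fun y => x - y))// => y.
  apply: continuous_comp; last exact: cg.
  by apply: continuousB; [exact: cst_continuous|exact: id].
have g1x : \int[mu]_y g (x - y) = 1.
  rewrite /Rintegral (_ : 1 = fine 1%:E)// -g1; congr fine.
  rewrite [RHS](@integral_affine R n (-1) x)//; last exact/measurable_EFinP.
  rewrite normrN1 expr1n mul1e; apply: eq_integral => y _.
  by rewrite scaleN1r addrC.
have -> : convol f g x - f x = \int[mu]_y ((f y - f x) * g (x - y)).
  have I3 : mu.-integrable setT (EFin \o (fun y => f x * g (x - y))).
    exact: (integrableZl measurableT (f x) I2).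
  rewrite -[X in _ - X]mulr1 -[X in _ - _ * X]g1x -RintegralZl// /convol -RintegralB//.
  by apply: eq_Rintegral => y _; rewrite mulrBl.
apply: (@le_trans _ _ (\int[mu]_y `|(f y - f x) * g (x - y)|%:E)%E).
  apply: normr_Rintegral_le; apply: measurable_funM => //.
  exact: measurable_funB.
rewrite (@integral_affine R n (-1) x)//; last first.
  apply/measurable_EFinP; apply: measurableT_comp => //.
  by apply: measurable_funM => //; exact: measurable_funB.
rewrite normrN1 expr1n mul1e le_eqVlt; apply/orP; left; apply/eqP.
by apply: eq_integral => y _; rewrite scaleN1r (addrC (- y)) subKr normrM.
Qed.

Lemma morrey_locally_integrable (p : \bar R) (w : R -> R) f (r : R) :
  (1 <= p)%E -> 0 < r -> 0 < w r -> measurable_fun setT f ->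
  (0 <= morrey_norm p w f < +oo)%E -> locally_integrable f.
Proof.
move=> p1 r0 wr mf /andP[f0 foo].
apply: (Lnorm_lty_locally_integrable p1 mf r0) => x.
rewrite -Lp_norm_restrict//; last exact: measurable_eball.
apply: (@le_lt_trans _ _ (fine (morrey_norm p w f) / w r)%:E); last exact: ltry.
by apply: Lp_norm_le_morrey => //; rewrite fineK// ge0_fin_numE.
Qed.

(** The Euclidean unit ball lies in the closed sup-norm unit ball, which is closed and so contains
    its closure. *)
Lemma supp_vanishes_beyond f : supp f `<=` closure (eball 0 1) -> vanishes_beyond 1 f.
Proof.
move=> fs x x1; apply/eqP; apply: contraT => fx.
have /fs : supp f x by apply: subset_closure.
have cK : closed [set y : V | `|y| <= 1].
  by apply: compact_closed; [exact: norm_hausdorff|exact: compact_norm_le].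
move=> /(closureS (_ : _ `<=` [set y : V | `|y| <= 1])) H.
have : closure [set y : V | `|y| <= 1] x.
  apply: H => y; rewrite /eball/= sub0r => y1.
  by rewrite -normrN (le_trans (norm_le_enorm _))// ltW.
by rewrite -(proj1 (closure_id _) cK)/= leNgt x1.
Qed.

Lemma morrey_norm_cst0 (p : \bar R) (w : R -> R) (D : R) : (1 <= p)%E ->
  (forall r, 0 < r -> 0 <= w r) -> 0 <= D ->
  (morrey_norm p w (cst 0%R : V -> R) <= D%:E)%E.
Proof.
move=> p1 w0 D0; apply: morrey_norm_le => // x r r0 wr.
rewrite Lp_norm_restrict//; last exact: measurable_eball.
rewrite (_ : EFin \o _ = cst 0%E); last first.
  by apply/funext => y; rewrite /patch/=; case: ifP.
rewrite Lnorm0; first by rewrite lee_fin divr_ge0// ltW.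
by apply/eqP => p0; move: p1; rewrite p0 lee_fin ler10.
Qed.

End approximate_identity.

(** * Mollification in Zorko's subspace *)

Theorem theorem13p3 (R : realType) (n : nat) (n_ge1 : (1 <= n)%N)
    (phi : 'rV[R]_n -> R)
    (phi_Coo_c : Coo_c phi)
    (phi_int : (\int[lebesgue_rV n]_(x in [set: rV_lebesgue n]) phi x)%R = 1)
    (phi_supp : supp phi `<=` closure (eball 0 1))
    (p : \bar R) (p_ge1 : (1 <= p)%E)
    (w : R -> R) (w_ge0 : forall r, 0 < r -> 0 <= w r)
    (w_neq0 : exists2 r0, 0 < r0 & w r0 != 0)
    (f : 'rV[R]_n -> R) (f_zorko : zorko p w f) :
  (forall eps, 0 < eps ->
     morrey p w (convolution f (dilate eps phi)) /\
     Coo (convolution f (dilate eps phi))) /\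
  morrey_cvg p w 0^'+ (fun eps => convolution f (dilate eps phi)) f.
Proof.
have [r0 r00 wr0N] := w_neq0.
have wr0 : 0 < w r0 by rewrite lt0r wr0N w_ge0.
have [[mf foo] fz] := f_zorko.
have [f' mf' ff'] := borel_modification mf.
have nf : morrey_norm p w f = morrey_norm p w f' by exact: morrey_norm_ae ff'.
have nf0 : (0 <= morrey_norm p w f')%E by exact: morrey_norm_ge0.
have lf : locally_integrable f'.
  by apply: (morrey_locally_integrable p_ge1 r00 wr0 mf'); rewrite nf0 -nf.
have cphi : continuous phi by exact: Ck_continuous (phi_Coo_c.1 0%N).
have phi1 := supp_vanishes_beyond phi_supp.
have iphi := integrable_vanishing cphi phi1.
have mphi := continuous_measurable_rV cphi.
pose psi t := dilate t phi.
have psik t k : Ck k (psi t) by apply: Ck_dilate; exact: (phi_Coo_c.1 k).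
have cpsi t : continuous (psi t) := Ck_continuous (psik t 0%N).
have mpsi t := continuous_measurable_rV (cpsi t).
have mnpsi t : measurable_fun setT (fun y => `|psi t y|).
  by apply: (measurableT_comp (@normr_measurable R setT)); exact: mpsi.
have psi0 t : 0 < t -> vanishes_beyond t (psi t).
  by move=> t0; have := vanishes_beyond_dilate t0 phi1; rewrite mulr1.
have convE t : convolution f (psi t) = convol f' (psi t) 
  by apply: (convolution_convol mf' ff'); exact: mpsi.
have conv_k t k : 0 < t -> Ck k (convol f' (psi t)).
  by move=> t0; apply: Ck_convol (psi0 t t0).
have mconv t : 0 < t -> measurable_fun setT (convol f' (psi t)).
  by move=> t0; apply: continuous_measurable_rV; exact: Ck_continuous (conv_k t 0%N t0).
(* [C] is the L^1 norm of [phi]; by [kpsi] it is also that of every dilate, which makes the bounds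
   uniform in [t]. *)
pose C := fine (\int[borel_lebesgue n]_y `|phi y|%:E)%E.
have Cfin : (\int[borel_lebesgue n]_y `|phi y|%:E = C%:E)%E.
  rewrite /C fineK// ge0_fin_numE; last by apply: integral_ge0.
  by have /integrableP[] := iphi.
have C0 : 0 <= C by rewrite -lee_fin -Cfin; apply: integral_ge0.
have kpsi t : 0 < t -> (\int[borel_lebesgue n]_y `|psi t y|%:E = C%:E)%E.
  move=> t0; rewrite -Cfin -(@integral_dilate _ _ (fun y => `|phi y|) t 1)//.
  - apply: eq_integral => y _; congr EFin.
    by rewrite /psi /dilate normrM ger0_norm// invr_ge0 exprn_ge0// ltW.
  - by move=> x; apply: continuous_comp; [exact: cphi|exact: norm_continuous].
  - by move=> x /phi1 ->; rewrite normr0.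
have psi1 t : 0 < t -> (\int[borel_lebesgue n]_y (psi t y)%:E = 1)%E.
  move=> t0; rewrite (integral_dilate t0 cphi phi1).
  have := ae_borel_Rintegral mphi (ae_borel_refl phi); rewrite phi_int /Rintegral => ->.
  by rewrite fineK//; exact: integrable_fin_num.
have mH : measurable_fun setT (fun z : 'rV[R]_n * 'rV[R]_n => f' (z.1 - z.2)).
  exact: (measurableT_comp mf' (@measurable_sub_rV R n)).
split=> [t t0|].
  rewrite -/(psi t) convE; split; last by move=> k; exact: conv_k.
  split; first exact: (ae_borel_measurable (mconv t t0) (ae_borel_refl _)).
  have D0 : 0 <= fine (morrey_norm p w f') by exact: fine_ge0.
  have Dfin : (fine (morrey_norm p w f'))%:E = morrey_norm p w f'.
    by rewrite fineK// ge0_fin_numE// -nf.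
  apply: le_lt_trans (ltry (C * fine (morrey_norm p w f'))).
  apply: (@morrey_norm_average _ _ _ _ p_ge1 w_ge0 _ (fun y => `|psi t y|) _ _ _ mH) => //.
  - exact: (mconv t t0).
  - exact: (kpsi t t0).
  - move=> y _; rewrite -[X in morrey_norm _ _ X]/(translate y f').
    by apply: morrey_norm_translate => //; rewrite Dfin.
  - by move=> x; apply: (convol_le x mf'); exact: mpsi.
apply/cvge0P => [t|e e0]; first exact: morrey_norm_ge0.
have C1 : 0 < C + 1 by rewrite ltr_wpDl.
(* Chosen so that [C * D <= e]; the added 1 spares a proof that [C] is positive. *)
pose D := e / (C + 1).
have D0 : 0 < D by rewrite divr_gt0.
have [d /= d0 Hd] : exists2 d : R, 0 < d & forall y : 'rV[R]_n, `|y| < d ->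
    (morrey_norm p w (fun x => f' (x - y) - f' x)%R <= D%:E)%E.
  have /cvge0P : morrey_norm p w (translate y f \- f) @[y --> (0 : 'rV[R]_n)^'] --> 0%E.
    exact: fz.
  move=> /(_ (fun y => morrey_norm_ge0 _ w_ge0 _) D D0).
  rewrite near_withinE => /nbhs_ballP[d /= d0 Hd]; exists d => // y yd.
  (* The limit in Zorko's condition is over a punctured neighbourhood, so [y = 0] is added by hand:
     the difference is then the zero function. *)
  have [->|y0] := eqVneq y 0.
    rewrite (_ : (fun x => _) = cst 0); first exact: morrey_norm_cst0 (ltW D0).
    by apply/funext => x; rewrite subr0 subrr.
  rewrite -(@morrey_norm_ae _ _ _ _ p_ge1 (translate y f \- f)).
  - by apply: Hd => //; rewrite mx_norm_ball /ball_/= sub0r normrN.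
  - by apply: measurable_funB => //; exact: measurable_translate.
  - exact: (ae_borel_op (fun a b : R => a - b) (ae_borel_translate y ff') ff').
near=> t.
have t0 : 0 < t by near: t; exact: nbhs_right_gt.
have td : t < d by near: t; exact: nbhs_right_lt.
rewrite -/(psi t) convE.
rewrite (@morrey_norm_ae _ _ _ _ p_ge1 _ (convol f' (psi t) \- f')); last 2 first.
- by apply: measurable_funB => //; exact: (mconv t t0).
- exact: (ae_borel_op (fun a b : R => a - b) (ae_borel_refl _) ff').
apply: (@le_trans _ _ (C * D)%:E); last first.
  by rewrite lee_fin /D mulrA ler_pdivrMr// mulrC ler_pM2l//; lra.
apply: (@morrey_norm_average _ _ _ _ p_ge1 w_ge0
  (fun z : 'rV[R]_n * 'rV[R]_n => f' (z.1 - z.2) - f' z.1) (fun y => `|psi t y|)) => //.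
- apply: measurable_funB => //; exact: (measurableT_comp mf' measurable_fst).
- by apply: measurable_funB => //; exact: (mconv t t0).
- exact: (kpsi t t0).
- exact: ltW.
(* Where [psi t] is nonzero, [|y| <= t < d], so only translations controlled by [Hd] enter the
   average. *)
- move=> y psiy; apply: Hd; apply: le_lt_trans td; rewrite leNgt; apply/negP => ty.
  by move: psiy; rewrite (psi0 t t0 y ty) normr0 eqxx.
- by move=> x; apply: (convol_sub_le x lf (cpsi t) (psi0 t t0)); exact: (psi1 t t0).
Unshelve. all: by end_near.
Qed.
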